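(* The group \[G=\langle a,b,c,s,t\mid sas^{-1}=ab,\ sbs^{-1}=b,\ scs^{-1}=c,\ tat^{-1}=ba,\ tbt^{-1}=b,\ tct^{-1}=c\rangle,\] which is of the form $F_3\rtimes F_2$ (with $F_3=F(a,b,c)$ and $F_2=F(s,t)$), has undecidable Diophantine problem.
   Context: The Diophantine problem for a finitely generated group $G$ asks for an algorithm that, given a finite system of equations over $G$ (elements of $G*F(\mathcal X)$ for a finite set of variables $\mathcal X$), decides whether there is a homomorphism $G*F(\mathcal X)\to G$ restricting to the identity on $G$ and sending each equation to $1$. *)

(* Defs.v *)
From Stdlib Require Import Relations.
From mathcomp Require Import all_boot.
Set Implicit Arguments. Unset Strict Implicit. Unset Printing Implicit Defensive.

Inductive recf : Type :=
| rZero : recf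
| rSucc : recf
| rProj : nat -> recf
| rComp : recf -> list recf -> recf
| rPrim : recf -> recf -> recf
| rMu   : recf -> recf.

Inductive reval : recf -> seq nat -> nat -> Prop :=
| ev_zero v : reval rZero v 0
| ev_succ x v : reval rSucc (x :: v) x.+1
| ev_proj i v : i < size v -> reval (rProj i) v (nth 0 v i)
| ev_comp f gs v ws y :
    revals gs v ws -> reval f ws y -> reval (rComp f gs) v y
| ev_prim0 f g v y : reval f v y -> reval (rPrim f g) (0 :: v) y
| ev_primS f g n v z y :
    reval (rPrim f g) (n :: v) z -> reval g (n :: z :: v) y ->
    reval (rPrim f g) (n.+1 :: v) y
| ev_mu f v n :
    reval f (n :: v) 0 ->
    (forall m, m < n -> exists k, reval f (m :: v) k.+1) ->
    reval (rMu f) v n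
with revals : list recf -> seq nat -> seq nat -> Prop :=
| evs_nil v : revals nil v [::]
| evs_cons g gs v w ws :
    reval g v w -> revals gs v ws -> revals (g :: gs) v (w :: ws).

Definition gen := 'I_5.
Definition ga : gen := @Ordinal 5 0 isT.
Definition gb : gen := @Ordinal 5 1 isT.
Definition gc : gen := @Ordinal 5 2 isT.
Definition gs : gen := @Ordinal 5 3 isT.
Definition gt : gen := @Ordinal 5 4 isT.

(* a letter (true, x) stands for x, (false, x) for x^-1 *)
Definition gword := seq (bool * gen).
Definition P (x : gen) : bool * gen := (true, x).
Definition N (x : gen) : bool * gen := (false, x).

Definition ginv (w : gword) : gword := rev (map (fun l => (~~ l.1, l.2)) w).

Definition relators : seq gword :=
  [:: [:: P gs; P ga; N gs; N gb; N ga];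
      [:: P gs; P gb; N gs; N gb];
      [:: P gs; P gc; N gs; N gc];
      [:: P gt; P ga; N gt; N ga; N gb];
      [:: P gt; P gb; N gt; N gb];
      [:: P gt; P gc; N gt; N gc]].

Inductive gstep : gword -> gword -> Prop :=
| gstep_red u v e x : gstep (u ++ (e, x) :: (~~ e, x) :: v) (u ++ v)
| gstep_rel u v r : r \in relators -> gstep (u ++ r ++ v) (u ++ v).

Definition eqG : gword -> gword -> Prop := clos_refl_sym_trans gword gstep.

(* Equations over G: words in G * F(X), X = {x_0, x_1, ...} (a system   *)
(* only ever mentions finitely many variables).                        *)
Definition eqletter := (bool * (gen + nat))%type.
Definition eqword := seq eqletter.
Definition eqsystem := seq eqword.

(* the homomorphism G * F(X) -> G which is the identity on G and sends
   x_i to (the element represented by) sigma i *)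
Definition subst_letter (sigma : nat -> gword) (l : eqletter) : gword :=
  match l with
  | (e, inl x) => [:: (e, x)]
  | (true, inr i) => sigma i
  | (false, inr i) => ginv (sigma i)
  end.

Definition subst (sigma : nat -> gword) (w : eqword) : gword :=
  flatten (map (subst_letter sigma) w).

Definition solvable (S : eqsystem) : Prop :=
  exists sigma : nat -> gword, forall w, w \in S -> eqG (subst sigma w) [::].

Definition diophantine_decidable : Prop :=
  exists f : recf, forall S : eqsystem,
    (solvable S -> reval f [:: pickle S] 1) /\
    (~ solvable S -> reval f [:: pickle S] 0).

(* Main.v *)
From Stdlib Require Import ZArith Lia FunctionalExtensionality Relations Setoid Morphisms.
From mathcomp Require Import all_boot zify.
Require Import Defs.
Set Implicit Arguments. Unset Strict Implicit. Unset Printing Implicit Defensive.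

(** Every relation defined by a recursive function is Diophantine over [nat]:
    exponentiation is Diophantine by Matiyasevich's analysis of Pell's equation,
    hence so are binomial coefficients and factorials, hence the Diophantine
    relations are closed under bounded universal quantification (Davis, Putnam
    and Robinson), and this handles primitive recursion and minimisation.

    Integers embed in [G] as the exponents in [s] of elements commuting with [s].
    Two elements of [<s, t>] that conjugate [a] to the same element have the same
    exponents in [s] and [t], because [s] and [t] multiply [a] by [b] on opposite
    sides.  An element commuting with [t s^m] has [s]-exponent equal to [m] times
    its [t]-exponent, which defines multiplication.  Soundness of the encoding is
    visible in a class-2 nilpotent quotient of [F_3] and a Heisenberg quotient of
    [F_2].  Together with Lagrange's four squares theorem, each Diophantine set of
    naturals is [{n | D and x_0 = s^n is solvable}] for some system [D].

    If [f] decided solvability, [n |-> f (code of (x_0 = s^n :: D))] with [n] the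
    code of [D] would have a Diophantine zero set, given by some system [D]; the
    code of this [D] is contradictory. *)

(** * Diophantine relations *)

(** A solution may send a variable to any element of [G]; membership in [<s, t>] is not imposed.
    Soundness therefore reads only the exponents in [s] and [t], and equations must compare these
    across arbitrary elements. The action on [a] and [b] is not enough: [s t^-1] conjugates [a] to
    [b^-1 a b], so [b s t^-1] centralises both [a] and [b]. It moves [c], however, and an element
    commuting with [a], [b] and [c] has both exponents zero. Conversely, a word in [s] and [t] acts
    on [F_3] through its two exponents only, so the canonical solutions consist of such words.

    Exponentiation is needed twice: for bounded quantification, and again in the diagonal step,
    because the parameter is written in unary as [s^n] and the code of the system is an iterated
    exponential of [n]. *)

Inductive pexp : Type :=
| Par of nat
| Wit of nat
| Cst of nat
| Add of pexp & pexp
| Mul of pexp & pexp.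

Fixpoint peval (e w : nat -> nat) (p : pexp) : nat :=
  match p with
  | Par i => e i
  | Wit i => w i
  | Cst c => c
  | Add p q => peval e w p + peval e w q
  | Mul p q => peval e w p * peval e w q
  end.

Fixpoint psubst (f g : nat -> pexp) (p : pexp) : pexp :=
  match p with
  | Par i => f i
  | Wit i => g i
  | Cst c => Cst c
  | Add p q => Add (psubst f g p) (psubst f g q)
  | Mul p q => Mul (psubst f g p) (psubst f g q)
  end.

Lemma peval_subst e w f g p :
  peval e w (psubst f g p) =
  peval (fun i => peval e w (f i)) (fun i => peval e w (g i)) p.
Proof. by elim: p => //= p -> q ->. Qed.

Definition poly (f : (nat -> nat) -> nat) : Prop :=
  exists p, forall e w, f e = peval e w p.

(** Coefficients are natural numbers, hence the two sides; valuations are infinite, so no arity is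
    tracked. *)
Definition dioph (R : (nat -> nat) -> Prop) : Prop :=
  exists p q, forall e, R e <-> exists w, peval e w p = peval e w q.

Lemma poly_par i : poly (fun e => e i).
Proof. by exists (Par i). Qed.

Lemma poly_cst c : poly (fun=> c).
Proof. by exists (Cst c). Qed.

Lemma poly_add f g : poly f -> poly g -> poly (fun e => f e + g e).
Proof.
by move=> [p Hp] [q Hq]; exists (Add p q) => e w /=; rewrite (Hp e w) (Hq e w).
Qed.

Lemma poly_mul f g : poly f -> poly g -> poly (fun e => f e * g e).
Proof.
by move=> [p Hp] [q Hq]; exists (Mul p q) => e w /=; rewrite (Hp e w) (Hq e w).
Qed.

Lemma poly_succ f : poly f -> poly (fun e => (f e).+1).
Proof.
by move=> [p Hp]; exists (Add p (Cst 1)) => e w /=; rewrite addn1 (Hp e w).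
Qed.

Lemma poly_expn f n : poly f -> poly (fun e => f e ^ n).
Proof.
move=> Hf; elim: n => [|n IH]; first exact: poly_cst.
by have [p Hp] := poly_mul Hf IH; exists p => e w; rewrite expnS.
Qed.

Lemma poly_comp f (g : nat -> nat) :
  poly f -> poly (fun e => f (fun i => e (g i))).
Proof.
move=> [p Hp]; exists (psubst (fun i => Par (g i)) Wit p) => e w.
by rewrite peval_subst /= (Hp _ w).
Qed.

Lemma dioph_ext R R' : (forall e, R e <-> R' e) -> dioph R -> dioph R'.
Proof. by move=> RR' [p [q Hpq]]; exists p, q => e; rewrite -RR'. Qed.

Lemma dioph_eq f g : poly f -> poly g -> dioph (fun e => f e = g e).
Proof.
move=> [p Hp] [q Hq]; exists p, q => e; split=> [fg | [w]].
  by exists (fun=> 0); rewrite -Hp -Hq.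
by rewrite -Hp -Hq.
Qed.

(** Even and odd positions keep two families of unknowns apart without counting variables. *)
Definition interleave T (a b : nat -> T) (i : nat) : T :=
  if odd i then b i./2 else a i./2.

Lemma interleave_even T (a b : nat -> T) i : interleave a b i.*2 = a i.
Proof. by rewrite /interleave odd_double doubleK. Qed.

Lemma interleave_odd T (a b : nat -> T) i : interleave a b i.*2.+1 = b i.
Proof. by rewrite /interleave /= odd_double uphalf_double. Qed.

Definition wit_even (i : nat) : pexp := Wit i.*2.
Definition wit_odd (i : nat) : pexp := Wit i.*2.+1.

Lemma peval_even e a b p :
  peval e (interleave a b) (psubst Par wit_even p) = peval e a p.
Proof.
rewrite peval_subst /=; congr peval.
by apply: functional_extensionality => i; rewrite interleave_even.
Qed.

Lemma peval_odd e a b p :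
  peval e (interleave a b) (psubst Par wit_odd p) = peval e b p.
Proof.
rewrite peval_subst /=; congr peval.
by apply: functional_extensionality => i; rewrite interleave_odd.
Qed.

(* [(p1 - q1)^2 + (p2 - q2)^2 = 0], with the negative terms moved to the right *)
Lemma dioph_and R1 R2 : dioph R1 -> dioph R2 -> dioph (fun e => R1 e /\ R2 e).
Proof.
move=> [p1 [q1 H1]] [p2 [q2 H2]].
pose E := psubst Par wit_even; pose O := psubst Par wit_odd.
pose sq p := Mul p p; pose db p q := Mul (Cst 2) (Mul p q).
exists (Add (Add (sq (E p1)) (sq (E q1))) (Add (sq (O p2)) (sq (O q2)))),
       (Add (db (E p1) (E q1)) (db (O p2) (O q2))) => e.
rewrite H1 H2; split=> [[[w1 Ew1] [w2 Ew2]] | [w]].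
  by exists (interleave w1 w2); rewrite /= !peval_even !peval_odd Ew1 Ew2; lia.
rewrite /= !peval_subst /=; set x1 := peval _ _ p1; set y1 := peval _ _ q1.
set x2 := peval _ _ p2; set y2 := peval _ _ q2 => Hw.
have [Exy1 Exy2] : x1 = y1 /\ x2 = y2.
  have sq1 := Z.square_nonneg (Z.of_nat x1 - Z.of_nat y1).
  have sq2 := Z.square_nonneg (Z.of_nat x2 - Z.of_nat y2).
  have e1 : ((Z.of_nat x1 - Z.of_nat y1) * (Z.of_nat x1 - Z.of_nat y1) = 0)%Z by lia.
  have e2 : ((Z.of_nat x2 - Z.of_nat y2) * (Z.of_nat x2 - Z.of_nat y2) = 0)%Z by lia.
  by move: e1 e2 => /Z.mul_eq_0 ? /Z.mul_eq_0 ?; lia.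
by split; eexists; [exact: Exy1 | exact: Exy2].
Qed.

(* [(p1 - q1) * (p2 - q2) = 0], with the negative terms moved to the right *)
Lemma dioph_or R1 R2 : dioph R1 -> dioph R2 -> dioph (fun e => R1 e \/ R2 e).
Proof.
move=> [p1 [q1 H1]] [p2 [q2 H2]].
pose E := psubst Par wit_even; pose O := psubst Par wit_odd.
exists (Add (Mul (E p1) (O p2)) (Mul (E q1) (O q2))),
       (Add (Mul (E p1) (O q2)) (Mul (E q1) (O p2))) => e.
rewrite H1 H2; split=> [[[w Ew] | [w Ew]] | [w]].
- by exists (interleave w w); rewrite /= !peval_even !peval_odd Ew; lia.
- by exists (interleave w w); rewrite /= !peval_even !peval_odd Ew; lia.
rewrite /= !peval_subst /=; set x1 := peval _ _ p1; set y1 := peval _ _ q1.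
set x2 := peval _ _ p2; set y2 := peval _ _ q2 => Hw.
have [Exy | Exy] : x1 = y1 \/ x2 = y2.
  have /Z.mul_eq_0 : ((Z.of_nat x1 - Z.of_nat y1) * (Z.of_nat x2 - Z.of_nat y2) = 0)%Z by lia.
  by lia.
  by left; eexists; exact: Exy.
by right; eexists; exact: Exy.
Qed.

(** Quantifying over a whole valuation serves families of unknowns of any length, such as the
    residues in [bounded_code] or the intermediate values of a composition. *)
Lemma dioph_exenv (R : (nat -> nat) -> (nat -> nat) -> Prop) :
  dioph (fun e => R (fun i => e i.*2) (fun i => e i.*2.+1)) ->
  dioph (fun e => exists a, R a e).
Proof.
move=> [p [q H]]; pose S := psubst (interleave wit_even Par) wit_odd.
exists (S p), (S q) => e.
have evS a w r : peval e (interleave a w) (S r) = peval (interleave a e) w r.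
  rewrite peval_subst; congr peval; apply: functional_extensionality => i.
    by rewrite /interleave; case: ifP => //= _; rewrite odd_double doubleK.
  by rewrite /= interleave_odd.
have HR a : R a e <-> exists w, peval (interleave a e) w p = peval (interleave a e) w q.
  rewrite -H; suff -> : (fun i => interleave a e i.*2) = a.
    suff -> : (fun i => interleave a e i.*2.+1) = e by [].
    by apply: functional_extensionality => i; rewrite interleave_odd.
  by apply: functional_extensionality => i; rewrite interleave_even.
split=> [[a /HR[w Ew]] | [w Ew]]; first by exists (interleave a w); rewrite !evS.
exists (fun i => w i.*2); apply/HR; exists (fun i => w i.*2.+1).
rewrite -!evS; suff -> : interleave (fun i => w i.*2) (fun i => w i.*2.+1) = w by [].
apply: functional_extensionality => i; rewrite /interleave.
by case: ifP => oi; congr w; rewrite -[RHS]odd_double_half oi.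
Qed.

Lemma dioph_subst (R : (nat -> nat) -> Prop) (f : nat -> (nat -> nat) -> nat)
    (s : nat -> pexp) :
  (forall i e w, f i e = peval e w (s i)) ->
  dioph R -> dioph (fun e => R (fun i => f i e)).
Proof.
move=> Hs [p [q H]]; exists (psubst s Wit p), (psubst s Wit q) => e.
have ev w r : peval e w (psubst s Wit r) = peval (fun i => f i e) w r.
  rewrite peval_subst /=; congr peval.
  by apply: functional_extensionality => i.
by rewrite H; split=> -[w Ew]; exists w; move: Ew; rewrite !ev.
Qed.

Lemma dioph_ren (R : (nat -> nat) -> Prop) (r : nat -> nat) :
  dioph R -> dioph (fun e => R (fun i => e (r i))).
Proof. exact: (dioph_subst (s := fun i => Par (r i))). Qed.

Lemma dioph_ex (R : nat -> (nat -> nat) -> Prop) :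
  dioph (fun e => R (e 0) (fun i => e i.+1)) -> dioph (fun e => exists x, R x e).
Proof.
move=> /(@dioph_ren _ (fun i => if i is j.+1 then j.*2.+1 else 0)) H.
apply: (@dioph_ext (fun e => exists a : nat -> nat, R (a 0) e)); last exact: dioph_exenv.
by move=> e; split=> [[a Ha] | [x Hx]]; [exists (a 0) | exists (fun=> x)].
Qed.

Lemma dioph_app2 (R : nat -> nat -> Prop) f g :
  dioph (fun e => R (e 0) (e 1)) -> poly f -> poly g ->
  dioph (fun e => R (f e) (g e)).
Proof.
move=> HR [p Hp] [q Hq].
by apply: (@dioph_subst _ (nth f [:: f; g]) (nth p [:: p; q]) _ HR) => [[|[|[|i]]]] //=.
Qed.

Lemma dioph_app3 (R : nat -> nat -> nat -> Prop) f g h :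
  dioph (fun e => R (e 0) (e 1) (e 2)) -> poly f -> poly g -> poly h ->
  dioph (fun e => R (f e) (g e) (h e)).
Proof.
move=> HR [p Hp] [q Hq] [r Hr].
by apply: (@dioph_subst _ (nth f [:: f; g; h]) (nth p [:: p; q; r]) _ HR) => [[|[|[|[|i]]]]] //=.
Qed.

Lemma dioph_app4 (R : nat -> nat -> nat -> nat -> Prop) f g h k :
  dioph (fun e => R (e 0) (e 1) (e 2) (e 3)) -> poly f -> poly g -> poly h ->
  poly k -> dioph (fun e => R (f e) (g e) (h e) (k e)).
Proof.
move=> HR [p Hp] [q Hq] [r Hr] [s Hs].
by apply: (@dioph_subst _ (nth f [:: f; g; h; k]) (nth p [:: p; q; r; s]) _ HR)
  => [[|[|[|[|[|i]]]]]] //=.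
Qed.

Lemma dioph_true : dioph (fun=> True).
Proof. by apply: dioph_ext (dioph_eq (poly_cst 0) (poly_cst 0)). Qed.

Lemma dioph_all_ltn (R : nat -> (nat -> nat) -> Prop) m :
  (forall i, i < m -> dioph (R i)) -> dioph (fun e => forall i, i < m -> R i e).
Proof.
elim: m => [|m IH] H; first by apply: dioph_ext dioph_true.
apply: dioph_ext (dioph_and (H m (leqnn _)) (IH _)) => [e|i im]; last by apply: H; lia.
split=> [[Rm Rlt] i | Rle]; last by split=> [|i im]; apply: Rle; lia.
by rewrite ltnS leq_eqVlt => /predU1P[-> | /Rlt].
Qed.

Ltac poly_tac :=
  repeat first [ assumption | exact: poly_par | exact: poly_cst
    | apply: poly_add | apply: poly_mul | apply: poly_succ | apply: poly_expn
    | apply: poly_comp ].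

Lemma dioph_le f g : poly f -> poly g -> dioph (fun e => f e <= g e).
Proof.
move=> Hf Hg; apply: (@dioph_ext (fun e => exists x, f e + x = g e)) => [e|].
  by split=> [[x <-] | fg]; [lia | exists (g e - f e); lia].
by apply: dioph_ex; apply: dioph_eq; poly_tac.
Qed.

Lemma dioph_dvd f g : poly f -> poly g -> dioph (fun e => f e %| g e).
Proof.
move=> Hf Hg; apply: (@dioph_ext (fun e => exists x, g e = x * f e)) => [e|].
  by split=> [[x ->] | /dvdnP]; [exact: dvdn_mull | ].
by apply: dioph_ex; apply: dioph_eq; poly_tac.
Qed.

Definition congr_mod (m x y : nat) : Prop := exists i j, x + i * m = y + j * m.

Lemma dioph_congr_mod f g h :
  poly f -> poly g -> poly h -> dioph (fun e => congr_mod (f e) (g e) (h e)).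
Proof.
by move=> Hf Hg Hh; apply: dioph_ex; apply: dioph_ex; apply: dioph_eq; poly_tac.
Qed.

Ltac dio :=
  repeat first [ apply: dioph_and | apply: dioph_or | apply: dioph_ex
    | apply: dioph_eq | apply: dioph_le | apply: dioph_dvd
    | apply: dioph_congr_mod ]; poly_tac.

(** * Pell's equation *)

(** [x + y sqrt(a^2 - 1)] is the [n]-th power of [a + sqrt(a^2 - 1)]. *)
Fixpoint pell (a : Z) (n : nat) : Z * Z :=
  if n is m.+1 then
    let: (x, y) := pell a m in ((a * x + (a * a - 1) * y)%Z, (x + a * y)%Z)
  else (1%Z, 0%Z).

Definition px a n := (pell a n).1.
Definition py a n := (pell a n).2.

Section Pell.

Local Open Scope Z_scope.

Lemma pxS a n : px a n.+1 = a * px a n + (a * a - 1) * py a n.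
Proof. by rewrite /px /py /=; case: (pell a n). Qed.

Lemma pyS a n : py a n.+1 = px a n + a * py a n.
Proof. by rewrite /px /py /=; case: (pell a n). Qed.

Lemma px0 a : px a 0 = 1. Proof. by []. Qed.
Lemma py0 a : py a 0 = 0. Proof. by []. Qed.

Lemma pell_eqn a n : px a n * px a n = 1 + (a * a - 1) * (py a n * py a n).
Proof.
elim: n => [|n IH]; first by rewrite px0 py0; ring.
by rewrite pxS pyS; ring [IH].
Qed.

Lemma pell_add a m n :
  px a (m + n) = px a m * px a n + (a * a - 1) * (py a m * py a n) /\
  py a (m + n) = px a m * py a n + py a m * px a n.
Proof.
elim: m => [|m [IHx IHy]]; first by rewrite px0 py0 add0n; lia.
by rewrite addSn !pxS !pyS IHx IHy; split; ring.
Qed.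

Lemma px_add a m n :
  px a (m + n) = px a m * px a n + (a * a - 1) * (py a m * py a n).
Proof. by have [] := pell_add a m n. Qed.

Lemma py_add a m n : py a (m + n) = px a m * py a n + py a m * px a n.
Proof. by have [] := pell_add a m n. Qed.

Lemma px_sub a m n : (n <= m)%N ->
  px a (m - n) = px a m * px a n - (a * a - 1) * (py a m * py a n).
Proof.
move=> nm; have E := pell_eqn a n.
rewrite -{2 3}(subnK nm) px_add py_add; set x := px a (m - n).
by transitivity (x * (px a n * px a n - (a * a - 1) * (py a n * py a n))); [rewrite E; ring | ring].
Qed.

Lemma pell_pos a n : 1 < a -> 0 < px a n /\ 0 <= py a n.
Proof.
move=> a1; elim: n => [|n [x0 y0]]; first by rewrite px0 py0.
have d0 : 0 < a * a - 1 by nia.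
by rewrite pxS pyS; move: (a * a - 1) d0 => d d0; split; nia.
Qed.

Lemma px_gt0 a n : 1 < a -> 0 < px a n.
Proof. by move=> a1; have [] := pell_pos n a1. Qed.

Lemma py_ge0 a n : 1 < a -> 0 <= py a n.
Proof. by move=> a1; have [] := pell_pos n a1. Qed.

Lemma py_mono a m n : 1 < a -> (m < n)%N -> py a m < py a n.
Proof.
move=> a1; elim: n => [|n IH] //; rewrite ltnS leq_eqVlt => mn.
have [x0 y0] := pell_pos n a1.
have step : py a n < py a n.+1 by rewrite pyS; nia.
by case/predU1P: mn => [-> | /IH]; lia.
Qed.

Lemma py_gt0 a n : 1 < a -> (0 < n)%N -> 0 < py a n.
Proof. by move=> a1 /(py_mono a1). Qed.

Lemma px_step a n : 1 < a -> 2 * px a n <= px a n.+1.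
Proof.
move=> a1; have [x0 y0] := pell_pos n a1; have d0 : 0 < a * a - 1 by nia.
by rewrite pxS; move: (a * a - 1) d0 => d d0; nia.
Qed.

Lemma px_step_lt a n : 1 < a -> (0 < n)%N -> 2 * px a n < px a n.+1.
Proof.
move=> a1 n0; have := px_gt0 n a1; have := py_gt0 a1 n0.
have d0 : 0 < a * a - 1 by nia.
by rewrite pxS; move: (a * a - 1) d0 => d d0; nia.
Qed.

Lemma px_mono a m n : 1 < a -> (m < n)%N -> px a m < px a n.
Proof.
move=> a1; elim: n => [|n IH] //; rewrite ltnS leq_eqVlt => mn.
have := @px_step a n a1; have := px_gt0 n a1.
by case/predU1P: mn => [-> | /IH]; lia.
Qed.

Lemma px_mono_le a m n : 1 < a -> (m <= n)%N -> px a m <= px a n.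
Proof.
by move=> a1; rewrite leq_eqVlt => /predU1P[-> | /(px_mono a1)]; lia.
Qed.

Lemma py_ge a n : 1 < a -> Z.of_nat n <= py a n.
Proof.
by move=> a1; elim: n => [|n IH] //; have := py_mono a1 (ltnSn n); lia.
Qed.

Lemma px_ge_pow a n : 1 < a -> a ^ Z.of_nat n <= px a n.
Proof.
move=> a1; elim: n => [|n IH] //; have [x0 y0] := pell_pos n a1.
have d0 : 0 < a * a - 1 by nia.
rewrite pxS Nat2Z.inj_succ Z.pow_succ_r; last lia.
by move: (a * a - 1) d0 => d d0; nia.
Qed.

(* Descent: multiply the solution by the inverse of the fundamental one. *)
Lemma pell_complete a x y : 1 < a -> 0 < x -> 0 <= y ->
  x * x = 1 + (a * a - 1) * (y * y) -> exists n, x = px a n /\ y = py a n.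
Proof.
move=> a1; move: {2}(Z.to_nat y).+1 (ltnSn (Z.to_nat y)) => N.
elim: N x y => // N IH x y yN x0 y0 E.
have [yz | yp] : y = 0 \/ 0 < y by lia.
  by exists 0%N; rewrite px0 py0; nia.
(* The three bounds say that the new [x] is positive and that the new [y] is nonnegative and smaller
   than [y]. *)
have h1 : (a * a - 1) * y < a * x.
  by apply: Z.square_lt_simpl_nonneg; nia.
have h2 : x <= a * y by apply: Z.square_le_simpl_nonneg; nia.
have h3 : (a - 1) * y < x by apply: Z.square_lt_simpl_nonneg; nia.
have [||||n [Ex Ey]] := IH (a * x - (a * a - 1) * y) (a * y - x); try lia.
exists n.+1; rewrite pxS pyS -Ex -Ey; split; ring.
Qed.

(** Modulo [a - 1] the recurrence becomes [x' = x], [y' = x + y]. *)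
Lemma py_mod a n : (a - 1 | px a n - 1) /\ (a - 1 | py a n - Z.of_nat n).
Proof.
elim: n => [|n [[i Hi] [j Hj]]]; first by split; exists 0; rewrite ?px0 ?py0.
rewrite pxS pyS Nat2Z.inj_succ; split.
  by exists (px a n + i + (a + 1) * py a n); lia.
by exists (i + py a n + j); lia.
Qed.

Lemma pell_mod a b m n : (m | a - b) ->
  (m | px a n - px b n) /\ (m | py a n - py b n).
Proof.
move=> [k Hk]; elim: n => [|n [[i Hi] [j Hj]]].
  by split; exists 0; rewrite ?px0 ?py0.
have -> : a = b + k * m by lia.
rewrite !pxS !pyS.
have Ex : px (b + k * m) n = px b n + i * m.
  by rewrite -Hi (_ : b + k * m = a); [ring | lia].
have Ey : py (b + k * m) n = py b n + j * m.
  by rewrite -Hj (_ : b + k * m = a); [ring | lia].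
rewrite {}Ex {}Ey; split.
  exists (b * i + k * px b n + k * i * m + (b * b - 1) * j
    + (2 * b * k + k * k * m) * (py b n + j * m)); ring.
by exists (i + b * j + k * py b n + k * j * m); ring.
Qed.

(** The modulus is [(a^2 - 1) - (a - n)^2], so [a - n] acts as a square root of [a^2 - 1], and
    [(a - sqrt(a^2 - 1))^k] becomes [n^k]. *)
Lemma px_pow_mod a n k :
  (2 * a * n - n * n - 1 | px a k - py a k * (a - n) - n ^ Z.of_nat k).
Proof.
elim: k => [|k [i Hi]]; first by exists 0; rewrite px0 py0.
exists (n * i + py a k); rewrite pxS pyS Nat2Z.inj_succ Z.pow_succ_r; last lia.
have -> : n ^ Z.of_nat k
  = px a k - py a k * (a - n) - i * (2 * a * n - n * n - 1) by lia.
ring.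
Qed.

Lemma gcd_py_px a n : Z.gcd (py a n) (px a n) = 1.
Proof.
apply: Z.bezout_1_gcd; exists (- ((a * a - 1) * py a n)), (px a n).
by have := pell_eqn a n; lia.
Qed.

Lemma py_dvd a n q : (py a n | py a (n * q)).
Proof.
elim: q => [|q [i Hi]]; first by rewrite muln0 py0; exact: Z.divide_0_r.
by rewrite mulnS py_add Hi; exists (px a (n * q) + px a n * i); ring.
Qed.

(** Write [k = n q + r]. As [y_n] divides [y_(nq)], it is coprime to [x_(nq)], and the addition
    formula gives [y_n | y_r] with [y_r < y_n]. *)
Lemma py_dvd_inv a n k : 1 < a -> (0 < n)%N -> (py a n | py a k) -> (n %| k)%N.
Proof.
move=> a1 n0; rewrite (divn_eq k n) mulnC py_add => -[i Hi].
have [j Hj] := py_dvd a n (k %/ n).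
have /Z.gauss : (py a n | px a (n * (k %/ n)) * py a (k %% n)).
  by exists (i - j * px a (k %% n)); nia.
case=> [|l Hl].
  apply: Z.bezout_1_gcd; exists (- ((a * a - 1) * (j * py a (n * (k %/ n))))).
  by exists (px a (n * (k %/ n))); have := pell_eqn a (n * (k %/ n)); nia.
have rn : (k %% n < n)%N by rewrite ltn_mod.
have := py_mono a1 rn; have := @py_ge0 a (k %% n) a1.
case: (posnP (k %% n)) => [-> * | r0]; first by rewrite addn0 dvdn_mulr.
have := py_gt0 a1 r0 => rp _ rlt; exfalso.
by have [] : l <= 0 \/ 1 <= l; [lia | nia | nia].
Qed.

(** Leading terms of the binomial expansion of [(x_n + y_n sqrt(a^2 - 1))^(k+1)]. *)
Lemma pell_mul_mod a n k : exists A B,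
  px a (n * k.+1) = px a n * Zpower_nat (px a n) k + A * (py a n * py a n) /\
  py a (n * k.+1) = Z.of_nat k.+1 * Zpower_nat (px a n) k * py a n
                    + B * (py a n * py a n * py a n).
Proof.
elim: k => [|k [A [B [Hx Hy]]]].
  exists 0, 0; rewrite muln1 (_ : Zpower_nat _ 0 = 1) // (_ : Z.of_nat 1 = 1) //.
  by split; ring.
rewrite mulnS px_add py_add Hx Hy Zpower_nat_succ_r (Nat2Z.inj_succ k.+1) /Z.succ.
set x := px a n; set y := py a n; set p := Zpower_nat x k.
exists (x * A + (a * a - 1) * (Z.of_nat k.+1 * p + B * (y * y))), (x * B + A).
split; ring.
Qed.

Lemma gauss_pow y x k z :
  Z.gcd y x = 1 -> (y | z * Zpower_nat x k) -> (y | z).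
Proof.
move=> g; elim: k => [|k IH]; first by rewrite /= Z.mul_1_r.
rewrite Zpower_nat_succ_r Z.mul_assoc (Z.mul_comm z) -Z.mul_assoc.
by move=> /Z.gauss/(_ g).
Qed.

(** With [k = n q], [y_k] is [q x_n^(q-1) y_n] modulo [y_n^3], and [x_n] is coprime to [y_n], so
    [y_n | q]. *)
Lemma py_sq_dvd a n k : 1 < a -> (0 < n)%N ->
  (py a n * py a n | py a k) -> (py a n | Z.of_nat k).
Proof.
move=> a1 n0 [i Hi]; have y0 := py_gt0 a1 n0.
have /dvdnP[q kq] : (n %| k)%N.
  by apply: (py_dvd_inv a1 n0); exists (i * py a n); lia.
case: q kq => [|q] kq; first by rewrite kq mul0n; exact: Z.divide_0_r.
have [A [B [_ Hy]]] := pell_mul_mod a n q.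
move: Hi; rewrite kq mulnC {}Hy => Hi.
have /(gauss_pow (gcd_py_px a n)) : (py a n | Z.of_nat q.+1 * Zpower_nat (px a n) q).
  exists (i - B * py a n); apply: (Z.mul_reg_r _ _ (py a n)); first lia.
  by move: Hi; set p := Zpower_nat _ _; lia.
by rewrite Nat2Z.inj_mul => /(Z.divide_mul_r _ (Z.of_nat n)).
Qed.

Lemma py_sq_dvd_mul a n m : (0 < m)%N -> (py a n | Z.of_nat m) ->
  (py a n * py a n | py a (n * m)).
Proof.
case: m => // m _ [i Hi]; have [A [B [_ ->]]] := pell_mul_mod a n m.
by rewrite Hi; exists (i * Zpower_nat (px a n) m + B * py a n); ring.
Qed.

(** Modulo [x_n] the square of [x_n + y_n sqrt(a^2 - 1)] is [-1]; hence also the period [4n]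
    below. *)
Lemma px_2n_add a n j : (px a n | px a (n + n + j) + px a j).
Proof.
rewrite px_add (px_add a n n) (py_add a n n).
have E := pell_eqn a n.
have -> : (a * a - 1) * (py a n * py a n) = px a n * px a n - 1 by lia.
by exists (2 * px a n * px a j + (a * a - 1) * (2 * py a n) * py a j); ring.
Qed.

Lemma px_2n_sub a n j : (j <= n + n)%N -> (px a n | px a (n + n - j) + px a j).
Proof.
move=> jn; rewrite (px_sub _ jn) (px_add a n n) (py_add a n n).
have E := pell_eqn a n.
have -> : (a * a - 1) * (py a n * py a n) = px a n * px a n - 1 by lia.
by exists (2 * px a n * px a j - (a * a - 1) * (2 * py a n) * py a j); ring.
Qed.

Lemma px_4n_add a n q r : (px a n | px a (q * (4 * n) + r) - px a r).
Proof.
elim: q => [|q [i Hi]]; first by rewrite mul0n add0n; exists 0; lia.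
have [j Hj] := px_2n_add a n (n + n + (q * (4 * n) + r)).
have [k Hk] := px_2n_add a n (q * (4 * n) + r).
have -> : (q.+1 * (4 * n) + r = n + n + (n + n + (q * (4 * n) + r)))%N.
  by rewrite mulSn; lia.
by exists (i + j - k); lia.
Qed.

Lemma divide_small m x : (m | x) -> 0 <= x < m -> x = 0.
Proof.
move=> [k ->] ?; have [k0 | [k0 | k0]] : k < 0 \/ k = 0 \/ 0 < k by lia.
- nia.
- by rewrite k0.
- nia.
Qed.

(** Modulo [x_n] the indices up to [2n] give [x_0 < ... < x_n], then [-x_(n-1), ..., -x_0]. The two
    halves are kept apart by [2 x_(n-1) <= x_n]; equality can occur only for [n = 1], where the
    collision is at index [0], excluded by [0 < i]. *)
Lemma px_inj_half a n i r : 1 < a -> (0 < i <= n)%N -> (r <= n + n)%N ->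
  (px a n | px a r - px a i) -> r = i.
Proof.
move=> a1 /andP[i0 iN] rN [k Hk].
have x0 m := px_gt0 m a1.
have [rn | nr] := leqP r n.
  have := px_mono_le a1 rn; have := px_mono_le a1 iN.
  case: (ltngtP r i) => // [ri | ir] h1 h2.
    have lt := px_mono a1 ri; have := x0 r.
    have D : (px a n | px a i - px a r) by exists (- k); lia.
    by have := divide_small D; lia.
  have := px_mono a1 ir; have := x0 i.
  by have := divide_small (ex_intro _ k Hk); lia.
have [l Hl] := px_2n_sub a rN.
have H : (px a n | px a (n + n - r) + px a i) by exists (l - k); lia.
have lt1 : (n + n - r < n)%N by lia.
have := px_mono a1 lt1; have := x0 (n + n - r)%N.
case: (ltngtP i n) iN => // [ilt | ieq] _ h1 h2; last first.
  case: H => c; rewrite ieq => Hc.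
  have D : (px a n | px a (n + n - r)) by exists (c - 1); lia.
  by have := divide_small D; lia.
have /px_mono_le-/(_ a a1) m1 : (i <= n.-1)%N by lia.
have /px_mono_le-/(_ a a1) m2 : (n + n - r <= n.-1)%N by lia.
have n1 : (0 < n.-1)%N by lia.
have := px_step_lt a1 n1; rewrite prednK; last lia.
by have := x0 i => ? ?; have := divide_small H; lia.
Qed.

(** Reduce [j] modulo [4n] to [r]; if [r > 2n], reflect it to [4n - r], which has the same [x]
    modulo [x_n]. *)
Lemma px_inj_mod a n i j : 1 < a -> (0 < i <= n)%N ->
  (px a n | px a j - px a i) ->
  (4 * Z.of_nat n | Z.of_nat j - Z.of_nat i) \/
  (4 * Z.of_nat n | Z.of_nat j + Z.of_nat i).
Proof.
move=> a1 iN H; have n0 : (0 < 4 * n)%N by lia.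
move: H; rewrite (divn_eq j (4 * n)); set q := (j %/ _)%N; set r := (j %% _)%N.
have rn : (r < 4 * n)%N by rewrite ltn_mod.
have [u Hu] := px_4n_add a n q r => -[v Hv].
have Hr : (px a n | px a r - px a i) by exists (v - u); lia.
have [r2 | r2] := leqP r (n + n).
  left; rewrite (px_inj_half a1 iN r2 Hr); exists (Z.of_nat q); lia.
right; have r4 : (4 * n - r <= n + n)%N by lia.
suff <- : (4 * n - r)%N = i by exists (Z.of_nat q + 1); lia.
apply: (px_inj_half a1 iN r4).
have [c Hc] := px_2n_add a n (r - (n + n)).
have [d Hd] := @px_2n_sub a n (r - (n + n)) ltac:(lia).
case: Hr => f Hf; exists (d - c + f).
move: Hc Hd; have -> : (n + n + (r - (n + n)) = r)%N by lia.
have -> : (n + n - (r - (n + n)) = 4 * n - r)%N by lia.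
lia.
Qed.

End Pell.

(** * The index of a Pell solution is Diophantine *)

Lemma congr_modZ m x y :
  congr_mod m x y <-> (Z.of_nat m | Z.of_nat x - Z.of_nat y)%Z.
Proof.
split=> [[i [j E]] | [k Hk]]; first by exists (Z.of_nat j - Z.of_nat i)%Z; lia.
have [k0 | k0] : (k <= 0 \/ 0 <= k)%Z by lia.
  by exists (Z.to_nat (- k)), 0; nia.
by exists 0, (Z.to_nat k); nia.
Qed.

Lemma dvdnZ m n : m %| n <-> (Z.of_nat m | Z.of_nat n)%Z.
Proof.
split=> [/dvdnP[k ->] | [k Hk]]; first by exists (Z.of_nat k); lia.
case: m Hk => [|m] Hk; first by rewrite dvd0n; lia.
by apply/dvdnP; exists (Z.to_nat k); nia.
Qed.

Lemma expnZ m n : Z.of_nat (m ^ n) = (Z.of_nat m ^ Z.of_nat n)%Z.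
Proof.
elim: n => [|n IH] //; rewrite expnS Nat2Z.inj_succ Z.pow_succ_r; last lia.
by rewrite -IH; lia.
Qed.

Definition pell_sol (a x y : nat) : Prop := x * x + y * y = 1 + a * a * (y * y).

Definition pell_rel (a k x y : nat) : Prop :=
  [/\ 1 < a, Z.of_nat x = px (Z.of_nat a) k & Z.of_nat y = py (Z.of_nat a) k].

Lemma pell_sol_index a x y : 1 < a -> pell_sol a x y -> exists k, pell_rel a k x y.
Proof.
move=> a1 E; have [|||| k [Ex Ey]] := @pell_complete (Z.of_nat a) (Z.of_nat x) (Z.of_nat y).
- lia.
- case: x E => [|x]; rewrite /pell_sol; last lia.
  have /(leq_pmull (y * y)) : 0 < a * a by rewrite muln_gt0; lia.
  lia.
- lia.
- by move: E; rewrite /pell_sol; lia.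
by exists k.
Qed.

Lemma pell_rel_sol a k x y : pell_rel a k x y -> pell_sol a x y.
Proof.
by case=> a1 Ex Ey; have := pell_eqn (Z.of_nat a) k; rewrite -Ex -Ey /pell_sol; lia.
Qed.

Lemma pell_rel_exists a k : 1 < a -> exists x y, pell_rel a k x y.
Proof.
move=> a1; have a1' : (1 < Z.of_nat a)%Z by lia.
have [x0 y0] := pell_pos k a1'.
exists (Z.to_nat (px (Z.of_nat a) k)), (Z.to_nat (py (Z.of_nat a) k)).
by split=> //; lia.
Qed.

Definition matiyasevich (a k x y : nat) : Prop :=
  k <= y /\ pell_sol a x y /\ exists u v s t b,
    pell_sol a u v /\ pell_sol b s t /\ 1 < b /\ congr_mod (4 * y) b 1 /\
    congr_mod u b a /\ 0 < v /\ y * y %| v /\ congr_mod u s x /\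
    congr_mod (4 * y) t k.

(** Let [i], [n], [j] be the indices of [y], [v], [t]. Since [b = a] modulo [u = x_n], the condition
    on [s] gives [x_j(a) = x_i(a)] modulo [x_n(a)], so [j] is [i] or [-i] modulo [4n]. From
    [y^2 | v] follows [y | n], and [b = 1] modulo [4y] gives [t = j] modulo [4y]. Thus [k] is [i] or
    [-i] modulo [4y]; as both are positive and at most [y], they are equal. *)
Lemma matiyasevich_pell a k x y :
  1 < a -> 0 < k -> matiyasevich a k x y -> pell_rel a k x y.
Proof.
move=> a1 k0 [ky [Hxy [u [v [s [t [b [Huv [Hst [b1 [cb1 [cba [v0 [yv [csx ctk]]]]]]]]]]]]]]].
have [i [_ xi yi]] := pell_sol_index a1 Hxy.
have [n [_ un vn]] := pell_sol_index a1 Huv.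
have [j [_ sj tj]] := pell_sol_index b1 Hst.
move: cb1 cba csx ctk yv => /congr_modZ cb1 /congr_modZ cba /congr_modZ csx /congr_modZ ctk /dvdnZ yv.
set A := Z.of_nat a in xi yi un vn cba *; set B := Z.of_nat b in sj tj cb1 cba.
have A1 : (1 < A)%Z by lia.
have i0 : 0 < i by case: i {xi} yi => // yi; move: yi; rewrite py0; lia.
have iN : i <= n.
  rewrite leqNgt; apply/negP => /(py_mono A1); rewrite -yi -vn => vy.
  by have := Z.divide_pos_le _ _ _ yv; nia.
have [[c Hc] _] := @pell_mod B A (Z.of_nat u) j cba.
have Dx : (px A n | px A j - px A i)%Z.
  by rewrite -un; case: csx => f Hf; exists (f - c)%Z; lia.
have [_ Dt] := py_mod B j.
have {Dt}[d Hd] := Z.divide_trans _ _ _ cb1 Dt.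
have [f Hf] : (Z.of_nat y | Z.of_nat n)%Z.
  by rewrite yi; apply: (py_sq_dvd A1 i0); rewrite -yi -vn -Nat2Z.inj_mul.
have iy : (Z.of_nat i <= Z.of_nat y)%Z by rewrite yi; exact: py_ge.
case: ctk => g Hg.
suff -> : k = i by [].
have [[h Hh] | [h Hh]] := px_inj_mod A1 (introT andP (conj i0 iN)) Dx.
  have D : (Z.of_nat (4 * y) | Z.of_nat k - Z.of_nat i)%Z.
    by exists (h * f + d - g)%Z; nia.
  have [ki | ik] := leqP i k.
    by have := divide_small D; lia.
  have D' : (Z.of_nat (4 * y) | Z.of_nat i - Z.of_nat k)%Z.
    by case: D => l Hl; exists (- l)%Z; lia.
  by have := divide_small D'; lia.
have D : (Z.of_nat (4 * y) | Z.of_nat k + Z.of_nat i)%Z.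
  by exists (h * f + d - g)%Z; nia.
by have := divide_small D; lia.
Qed.

Lemma pell_matiyasevich a k x y :
  0 < k -> pell_rel a k x y -> matiyasevich a k x y.
Proof.
move=> k0 Rxy; have [a1 Ex Ey] := Rxy.
set A := Z.of_nat a in Ex Ey; have A1 : (1 < A)%Z by lia.
have y0 : 0 < y by have := py_gt0 A1 k0; lia.
split; first by have := @py_ge A k A1; lia.
split; first exact: pell_rel_sol Rxy.
(* The factor [y] in the index yields [y^2 | v]; the factor [2] yields [2y | v], which makes [u]
   coprime to [4y]. *)
have [u [v Ruv]] := pell_rel_exists (k * (2 * y)) a1; have [_ Eu Ev] := Ruv.
have [c Hc] : (2 * Z.of_nat y | Z.of_nat v)%Z.
  rewrite Ev (_ : k * (2 * y) = k * y + k * y); last lia.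
  rewrite py_add -/A; have [c Hc] := py_dvd A k y.
  by exists (px A (k * y) * c)%Z; rewrite Hc -Ey; ring.
have [al [be Hab]] : Z.Bezout (Z.of_nat u) (4 * Z.of_nat y) 1.
  exists (Z.of_nat u), (- ((A * A - 1) * (c * c * Z.of_nat y)))%Z.
  by have := pell_eqn A (k * (2 * y)); rewrite -Eu -Ev Hc; lia.
(* Chinese remainders: [b0] is [a] modulo [u] and [1] modulo [4y]. Adding [N] times the product of
   the moduli makes it exceed [1]. *)
pose b0 := (A + al * Z.of_nat u * (1 - A))%Z.
pose N := (Z.abs b0 + 2)%Z.
pose bz := (b0 + N * (4 * Z.of_nat y * Z.of_nat u))%Z.
have u0 : (0 < Z.of_nat u)%Z by rewrite Eu; exact: px_gt0.
have b1 : (1 < bz)%Z.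
  have : (1 <= 4 * Z.of_nat y * Z.of_nat u)%Z by nia.
  by rewrite /bz /N; move: (4 * Z.of_nat y * Z.of_nat u)%Z => P; nia.
have Eb : Z.of_nat (Z.to_nat bz) = bz by lia.
have b1' : 1 < Z.to_nat bz by lia.
have [s [t Rst]] := pell_rel_exists k b1'; have [_ Es Et] := Rst.
have cb1 : (Z.of_nat (4 * y) | bz - 1)%Z.
  exists ((A - 1) * be + N * Z.of_nat u)%Z.
  have -> : Z.of_nat (4 * y) = (4 * Z.of_nat y)%Z by lia.
  transitivity ((A - 1) * (be * (4 * Z.of_nat y)) + N * (4 * Z.of_nat y * Z.of_nat u))%Z;
    last ring.
  have -> : (be * (4 * Z.of_nat y) = 1 - al * Z.of_nat u)%Z by lia.
  by rewrite /bz /b0; ring.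
have cba : (Z.of_nat u | bz - A)%Z.
  by exists (al * (1 - A) + N * (4 * Z.of_nat y))%Z; rewrite /bz /b0; ring.
exists u, v, s, t, (Z.to_nat bz).
split; first exact: pell_rel_sol Ruv.
split; first exact: pell_rel_sol Rst.
split=> //.
split; first by apply/congr_modZ; rewrite Eb.
split; first by apply/congr_modZ; rewrite Eb.
split.
  have m0 : 0 < k * (2 * y) by rewrite muln_gt0 k0; lia.
  by have := py_gt0 A1 m0; rewrite -Ev; lia.
split.
  apply/dvdnZ; rewrite Nat2Z.inj_mul Ey Ev; apply: py_sq_dvd_mul; first lia.
  by rewrite -Ey; exists 2%Z; lia.
split; first by apply/congr_modZ; rewrite Es Ex Eb; have [] := pell_mod k cba.
apply/congr_modZ; rewrite Et Eb; apply: Z.divide_trans cb1 _.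
by have [] := py_mod bz k.
Qed.

Lemma dioph_pell_sol f g h : poly f -> poly g -> poly h ->
  dioph (fun e => pell_sol (f e) (g e) (h e)).
Proof. by move=> *; rewrite /pell_sol; dio. Qed.

Lemma dioph_pell_rel f g h k : poly f -> poly g -> poly h -> poly k ->
  dioph (fun e => pell_rel (f e) (g e) (h e) (k e)).
Proof.
apply: dioph_app4.
apply: (@dioph_ext (fun e => 1 < e 0 /\ ((e 1 = 0 /\ e 2 = 1 /\ e 3 = 0) \/
  (0 < e 1 /\ matiyasevich (e 0) (e 1) (e 2) (e 3))))) => [e|].
  split=> [[a1 [[-> [-> ->]] | [k0 M]]] | R].
  - by split.
  - exact: matiyasevich_pell.
  have [a1 Ex Ey] := R; split=> //.
  case: (posnP (e 1)) => k0; [left | right; split=> //; exact: pell_matiyasevich].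
  by move: Ex Ey; rewrite k0 px0 py0; lia.
rewrite /matiyasevich.
by repeat first [ apply: dioph_and | apply: dioph_or | apply: dioph_ex
  | apply: dioph_pell_sol | progress dio ].
Qed.

(** * Exponentiation from Pell sequences *)

Lemma expn_lt_pell w n k : 0 < k -> k <= w -> n <= w -> n ^ k < w.+1 ^ w.
Proof.
move=> k0 kw nw; apply: (@leq_ltn_trans (w ^ k)); first by rewrite leq_exp2r.
apply: (@leq_ltn_trans (w ^ w)); last by rewrite ltn_exp2r //; lia.
by apply: leq_pexp2l => //; lia.
Qed.

(* [n ^ k] is the residue of [x_k - y_k (a - n)] modulo [2 a n - n^2 - 1]; the
   Pell equation with parameter [w + 1] forces [a] to exceed [n ^ k]. *)
Lemma expn_pellP n k m : 0 < n -> 0 < k ->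
  m = n ^ k <-> exists w a t z x y,
    pell_rel a k x y /\ congr_mod t (x + y * n) (y * a + m) /\
    2 * a * n = t + (n * n + 1) /\ m < t /\ n <= w /\ k <= w /\
    pell_sol w.+1 a (w * z).
Proof.
move=> n0 k0.
have bound a t : n ^ k < a -> 2 * a * n = t + (n * n + 1) -> n ^ k < t.
  have : n <= n ^ k by rewrite -{1}(expn1 n) leq_pexp2l.
  by move: (n ^ k) => N nN Na Et; nia.
have cong a t x y : pell_rel a k x y -> 2 * a * n = t + (n * n + 1) ->
    congr_mod t (x + y * n) (y * a + n ^ k).
  case=> a1 Ex Ey Et; apply/congr_modZ.
  have [i] := px_pow_mod (Z.of_nat a) (Z.of_nat n) k.
  by rewrite -Ex -Ey -expnZ => Hi; exists i; nia.
split=> [-> | [w [a [t [z [x [y [R [C [Et [mt [nw [kw S]]]]]]]]]]]]].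
  pose w := n + k; have w1 : 1 < w.+1 by lia.
  have [a [v Rav]] := pell_rel_exists w w1; have [_ Ea Ev] := Rav.
  have W1 : (1 < Z.of_nat w.+1)%Z by lia.
  have alt : n ^ k < a.
    apply: (@leq_trans (w.+1 ^ w)); first by apply: expn_lt_pell => //; lia.
    by have := @px_ge_pow _ w W1; rewrite -expnZ -Ea; lia.
  have [z Hz] : exists z, v = w * z.
    have [_ [i Hi]] := py_mod (Z.of_nat w.+1) w.
    have /dvdnZ/dvdnP[z ->] : (Z.of_nat w | Z.of_nat v)%Z by exists (i + 1)%Z; nia.
    by exists z; rewrite mulnC.
  have a1 : 1 < a by apply: leq_ltn_trans alt; rewrite expn_gt0 n0.
  have [x [y R]] := pell_rel_exists k a1.
  have na : n < a by apply: leq_ltn_trans alt; rewrite -{1}(expn1 n) leq_pexp2l.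
  have Et : 2 * a * n = (2 * a * n - (n * n + 1)) + (n * n + 1) by nia.
  exists w, a, (2 * a * n - (n * n + 1)), z, x, y.
  split=> //; split; first exact: cong.
  split=> //; split; first exact: bound Et.
  by split; [lia | split; [lia | rewrite -Hz; exact: pell_rel_sol Rav]].
have [a1 _ _] := R; have w1 : 1 < w.+1 by lia.
have [j [_ Ea Ez]] := pell_sol_index w1 S.
have W1 : (1 < Z.of_nat w.+1)%Z by lia.
(* [y_j(w + 1)] is [j] modulo [w] and equals [w z], so [w | j]; [a > 1] excludes [j = 0]. Hence
   [a >= (w + 1)^w]. *)
have wj : w <= j.
  have [_ [i Hi]] := py_mod (Z.of_nat w.+1) j.
  have /dvdnZ wj : (Z.of_nat w | Z.of_nat j)%Z by exists (Z.of_nat z - i)%Z; nia.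
  apply: dvdn_leq wj; case: j Ea {Ez Hi} => // Ea.
  by move: Ea; rewrite px0; lia.
have alt : n ^ k < a.
  apply: (@leq_trans (w.+1 ^ w)); first by apply: expn_lt_pell.
  apply: (@leq_trans (w.+1 ^ j)); first by apply: leq_pexp2l.
  by have := @px_ge_pow _ j W1; rewrite -expnZ -Ea; lia.
have /congr_modZ[i Hi] := cong _ _ _ _ R Et; move: C => /congr_modZ[l Hl].
have nt := bound _ _ alt Et.
have [mn | nm] := leqP m (n ^ k).
  have D : (Z.of_nat t | Z.of_nat (n ^ k) - Z.of_nat m)%Z by exists (l - i)%Z; lia.
  by have := divide_small D; lia.
have D : (Z.of_nat t | Z.of_nat m - Z.of_nat (n ^ k))%Z by exists (i - l)%Z; lia.
by have := divide_small D; lia.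
Qed.

Lemma dioph_expn f g h : poly f -> poly g -> poly h ->
  dioph (fun e => f e = g e ^ h e).
Proof.
apply: (@dioph_app3 (fun m n k => m = n ^ k)).
apply: (@dioph_ext (fun e => (e 2 = 0 /\ e 0 = 1) \/ ((0 < e 2 /\ e 1 = 0 /\ e 0 = 0) \/
  (0 < e 1 /\ 0 < e 2 /\ exists w a t z x y,
    pell_rel a (e 2) x y /\ congr_mod t (x + y * e 1) (y * a + e 0) /\
    2 * a * e 1 = t + (e 1 * e 1 + 1) /\ e 0 < t /\ e 1 <= w /\ e 2 <= w /\
    pell_sol w.+1 a (w * z))))) => [e|].
  split=> [[[-> ->] // | [[k0 [-> ->]] | [n0 [k0 H]]]] | ].
  - by rewrite exp0n.
  - by apply/expn_pellP.
  move=> E; case: (posnP (e 2)) => [k0 | k0]; first by left; rewrite E k0.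
  right; case: (posnP (e 1)) => [n0 | n0]; first by left; rewrite E n0 exp0n.
  by right; split=> //; split=> //; apply/expn_pellP.
by repeat first [ apply: dioph_and | apply: dioph_or | apply: dioph_ex
  | apply: dioph_pell_sol | apply: dioph_pell_rel | progress dio ].
Qed.

(** * Digits, binomial coefficients and factorials *)

(** Quotient and remainder are unknowns, so no division is left to define. Finite sequences will be
    coded as numbers in base [r]. *)
Definition digit (c r i z : nat) : Prop :=
  z < r /\ exists h l p, p = r ^ i /\ c = (h * r + z) * p + l /\ l < p.

Lemma digitP c r i z : digit c r i z <-> 0 < r /\ z = c %/ r ^ i %% r.
Proof.
split=> [[zr [h [l [_ [-> [-> lp]]]]]] | [r0 ->]].
  by split; [lia | rewrite divnMDl ?divn_small ?addn0 ?modnMDl ?modn_small; lia].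
split; first by rewrite ltn_mod.
exists (c %/ r ^ i %/ r), (c %% r ^ i), (r ^ i).
by rewrite -!divn_eq ltn_mod expn_gt0 r0.
Qed.

Lemma digit_sum r N (d : nat -> nat) i : (forall j, j < N -> d j < r) -> i < N ->
  digit (\sum_(j < N) d j * r ^ j) r i (d i).
Proof.
move=> dr iN; have r0 : 0 < r by have := dr i iN; lia.
apply/digitP; split=> //; elim: N d i dr iN => // N IH d i dr iN.
rewrite big_ord_recl /= expn0 muln1.
have -> : \sum_(j < N) d (bump 0 j) * r ^ bump 0 j = (\sum_(j < N) d j.+1 * r ^ j) * r.
  by rewrite big_distrl; apply: eq_bigr => j _ /=; rewrite -mulnA -expnSr.
have d0 : d 0 < r by exact: dr.
rewrite addnC; case: i iN => [|i] iN; first by rewrite expn0 divn1 modnMDl modn_small.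
rewrite expnS divnMA divnMDl // (divn_small d0) addn0.
by apply: (IH (fun j => d j.+1)) => // j jN; apply: dr.
Qed.

Lemma dioph_digit f g h k : poly f -> poly g -> poly h -> poly k ->
  dioph (fun e => digit (f e) (g e) (h e) (k e)).
Proof.
move=> *; apply: dioph_and; first by dio.
do 3 apply: dioph_ex; apply: dioph_and; last by dio.
by apply: dioph_expn; poly_tac.
Qed.

Lemma bin_le_exp2 n k : 'C(n, k) <= 2 ^ n.
Proof.
elim: n k => [|n IH] [|k] //; first by rewrite bin0 expn_gt0.
by rewrite binS expnS mul2n -addnn leq_add.
Qed.

(** The base [r = 2^n + 1] exceeds every coefficient, so the expansion of [(1 + r)^n] has no
    carries. *)
Lemma binomial_digit n k : k <= n ->
  digit ((2 ^ n).+2 ^ n) (2 ^ n).+1 k 'C(n, k).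
Proof.
move=> kn; rewrite -(addn1 (2 ^ n).+1) addnC expnDn.
rewrite (eq_bigr (fun i : 'I_n.+1 => 'C(n, i) * (2 ^ n).+1 ^ i)); last first.
  by move=> i _; rewrite exp1n mul1n.
by apply: (@digit_sum _ _ (fun i => 'C(n, i))) => // j _; rewrite ltnS bin_le_exp2.
Qed.

Lemma dioph_binomial f g h : poly f -> poly g -> poly h ->
  dioph (fun e => f e = 'C(g e, h e)).
Proof.
apply: (@dioph_app3 (fun y n k => y = 'C(n, k))).
apply: (@dioph_ext (fun e => (e 1 < e 2 /\ e 0 = 0) \/ (e 2 <= e 1 /\ exists u v,
   u = 2 ^ e 1 /\ v = u.+2 ^ e 1 /\ digit v u.+1 (e 2) (e 0)))) => [e|].
  split=> [[[lt ->] | [le [_ [_ [-> [-> D]]]]]] | ->].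
  - by rewrite bin_small.
  - move: D (binomial_digit le) => /digitP[_ ->] /digitP[_ ->] //.
  have [le | lt] := leqP (e 2) (e 1); last by left; rewrite bin_small.
  by right; split=> //; do 2 eexists; do 2 (split; first by []); apply: binomial_digit.
apply: dioph_or; first by dio.
apply: dioph_and; first by dio.
do 2 apply: dioph_ex; apply: dioph_and; first by apply: dioph_expn; poly_tac.
by apply: dioph_and; [apply: dioph_expn | apply: dioph_digit]; poly_tac.
Qed.

Lemma ffact_le_exp r j : r ^_ j <= r ^ j.
Proof.
by elim: j => // j IH; rewrite ffactnSr expnSr leq_mul // leq_subr.
Qed.

(** Each of the [j] factors of the falling factorial falls short of [r] by at most [n]; denominators
    are cleared. *)
Lemma exp_le_ffact n r j : j <= n -> n <= r ->
  r ^ j.+1 <= r * r ^_ j + n * j * r ^ j.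
Proof.
move=> jn nr; elim: j jn => [|j IH] jn; first by rewrite ffactn0 expn1; lia.
have {}IH := IH (ltnW jn); have le := ffact_le_exp r j.
rewrite ffactnSr !expnS; move: IH le; rewrite expnS.
have h1 : r * (r ^_ j * (r - j)) + r * (r ^_ j * j) = r * (r ^_ j * r).
  by rewrite -!mulnDr subnK //; lia.
move: (r - j) (r ^_ j) (r ^ j) h1 => q F E h1 IH le.
have h2 := leq_mul (leqnn r) IH.
have h3 : r * (F * j) <= r * (E * n) by rewrite leq_mul // leq_mul // ltnW.
lia.
Qed.

(** Robinson's formula: [n!] is the integer part of [r^n / C(r, n)] for large [r], the relative
    error being at most [n^2 / r < 1 / (n! + 1)]. *)
Lemma fact_div n r : n <= r -> n * n * (n`! + 1) < r ->
  n`! * 'C(r, n) <= r ^ n < (n`! + 1) * 'C(r, n).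
Proof.
move=> nr big; have := exp_le_ffact (leqnn n) nr; have := ffact_le_exp r n.
rewrite -bin_ffact expnS mulnC => -> /=.
have : 0 < n`! by exact: fact_gt0.
have : 0 < r ^ n by rewrite expn_gt0; lia.
move: (r ^ n) 'C(r, n) (n`!) big => E C F big E0 F0 H; rewrite ltnNge; apply/negP => le.
have {}H : r * (E - C * F) <= n * n * E by rewrite mulnBr; lia.
have {}le : E <= (F + 1) * (E - C * F) by rewrite mulnBr; nia.
have D0 : 0 < E - C * F by rewrite lt0n; apply/negP => /eqP D; move: le; rewrite D; lia.
have := leq_mul (leqnn (n * n)) le; have : n * n * (F + 1) * (E - C * F) < r * (E - C * F).
  by rewrite ltn_pmul2r.
lia.
Qed.

(** The choice of [r] needs only an upper bound of the factorial, and [n^n] is one already known to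
    be Diophantine. *)
Lemma dioph_factorial f g : poly f -> poly g -> dioph (fun e => f e = (g e)`!).
Proof.
apply: (@dioph_app2 (fun y n => y = n`!)).
apply: (@dioph_ext (fun e => exists q r c p, q = e 1 ^ e 1 /\
   r = e 1 * e 1 * (q + 1) + e 1 + 1 /\ c = 'C(r, e 1) /\ p = r ^ e 1 /\
   e 0 * c <= p /\ p < (e 0 + 1) * c)) => [e|].
  have le : (e 1)`! <= e 1 ^ e 1 by rewrite -ffactnn ffact_le_exp.
  have key : let r := e 1 * e 1 * (e 1 ^ e 1 + 1) + e 1 + 1 in
      (e 1)`! * 'C(r, e 1) <= r ^ e 1 < ((e 1)`! + 1) * 'C(r, e 1).
    by move=> r; apply: fact_div; rewrite /r; nia.
  split=> [[_ [_ [_ [_ [-> [-> [-> [-> [lo hi]]]]]]]]] | ->].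
    by move: key => /= /andP[]; nia.
  by do 4 eexists; do 4 (split; first by []); apply/andP.
do 4 apply: dioph_ex.
apply: dioph_and; first by apply: dioph_expn; poly_tac.
apply: dioph_and; first by dio.
apply: dioph_and; first by apply: dioph_binomial; poly_tac.
apply: dioph_and; first by apply: dioph_expn; poly_tac.
by dio.
Qed.

(** * Bounded universal quantification *)

Lemma congr_modP m x y : congr_mod m x y <-> x = y %[mod m].
Proof.
split=> [[i [j E]] | E].
  by rewrite -(modnMDl i x m) addnC E addnC modnMDl.
exists (y %/ m), (x %/ m).
by rewrite {1}(divn_eq x m) {2}(divn_eq y m) E; lia.
Qed.

Lemma coprime_prod x (m : nat -> nat) n :
  (forall i, i < n -> coprime x (m i)) -> coprime x (\prod_(i < n) m i).
Proof.
move=> cop; apply: (big_ind (fun y => coprime x y)) => [|y z Hy Hz|i _].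
- exact: coprimen1.
- by rewrite coprimeMr Hy.
- exact: cop.
Qed.

Lemma chinese_prod (m : nat -> nat) n x y :
  (forall i j, i < n -> j < n -> i <> j -> coprime (m i) (m j)) ->
  (forall i, i < n -> x = y %[mod m i]) -> x = y %[mod \prod_(i < n) m i].
Proof.
elim: n => [|n IH] cop xy; first by rewrite big_ord0 !modn1.
have copn : coprime (\prod_(i < n) m i) (m n).
  by rewrite coprime_sym; apply: coprime_prod => i iN; apply: cop; lia.
rewrite big_ord_recr /=; apply/eqP; rewrite chinese_remainder //.
apply/andP; split; apply/eqP; last exact: xy.
by apply: IH => *; [apply: cop | apply: xy]; lia.
Qed.

Lemma chinese_exists (m y : nat -> nat) n :
  (forall i j, i < n -> j < n -> i <> j -> coprime (m i) (m j)) ->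
  exists a, forall i, i < n -> a = y i %[mod m i].
Proof.
elim: n => [|n IH] cop; first by exists 0.
have [|a Ha] := IH; first by move=> *; apply: cop; lia.
have copn : coprime (\prod_(i < n) m i) (m n).
  by rewrite coprime_sym; apply: coprime_prod => i iN; apply: cop; lia.
exists (chinese (\prod_(i < n) m i) (m n) a (y n)) => i.
rewrite ltnS leq_eqVlt => /predU1P[-> | iN]; first exact: chinese_modr.
rewrite -Ha //; have /(modn_dvdm (chinese (\prod_(i < n) m i) (m n) a (y n))) <- :
  m i %| \prod_(i < n) m i by rewrite (bigD1 (Ordinal iN)) //= dvdn_mulr.
rewrite chinese_modl // modn_dvdm // (bigD1 (Ordinal iN)) //=.
exact: dvdn_mulr.
Qed.

Lemma finite_choice T (C : nat -> T -> Prop) n (x0 : T) :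
  (forall k, k < n -> exists x, C k x) -> exists g, forall k, k < n -> C k (g k).
Proof.
elim: n => [|n IH] H; first by exists (fun=> x0).
have [|g Hg] := IH; first by move=> k kn; apply: H; lia.
have [x Hx] := H n (ltnSn n); exists (fun k => if k == n then x else g k) => k.
by case: eqVneq => [-> | kn] // ?; apply: Hg; lia.
Qed.

(* The moduli [t / j - 1] multiply to [C(t - 1, n)], so no separate treatment of
   products is needed, and [t = j] modulo [t / j - 1] recovers the index. *)
Definition modulus (t k : nat) : nat := t %/ k.+1 - 1.

(** The reason for squaring [B!]: after division by [k + 1] a multiple of [B!] remains, so
    subtracting [1] leaves no prime factor up to [B]. *)
Lemma modulus_fact B k : k < B ->
  B`! %| (B`! * B`!) %/ k.+1 /\ k.+1 * ((B`! * B`!) %/ k.+1) = B`! * B`!.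
Proof.
move=> kB; have d : k.+1 %| B`! by rewrite dvdn_fact.
rewrite -muln_divA; first by rewrite dvdn_mulr // mulnCA [k.+1 * _]mulnC divnK.
exact: d.
Qed.

Lemma modulus_prime B k p : k < B -> prime p -> p %| modulus (B`! * B`!) k ->
  B < p /\ B`! * B`! = k.+1 %[mod p].
Proof.
move=> kB pp; have [/dvdnP[q Eq] Et] := modulus_fact kB.
have f0 := fact_gt0 B; have q0 : 0 < q.
  by case: q Eq => // Eq; move: Et; rewrite Eq mul0n muln0; nia.
rewrite /modulus Eq => pd; rewrite -Et Eq; split.
  rewrite ltnNge; apply/negP => pB.
  have : p %| q * B`! by rewrite dvdn_mull // dvdn_fact // prime_gt0.
  move=> d2; have : p %| 1 by rewrite -(dvdn_addr 1 pd) subnK // muln_gt0 q0.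
  by rewrite dvdn1 => /eqP p1; move: pp; rewrite p1.
case/dvdnP: pd => c Hc.
have -> : q * B`! = c * p + 1 by rewrite -Hc subnK // muln_gt0 q0.
by rewrite mulnDr muln1 mulnA modnMDl.
Qed.

Lemma modulus_gt1 B k : 2 < B -> k < B -> 1 < modulus (B`! * B`!) k.
Proof.
move=> B2 kB; have [/dvdn_leq le Et] := modulus_fact kB.
have f2 : 2 < B`! by apply: leq_trans B2 (fact_geq _).
have : B`! <= (B`! * B`!) %/ k.+1.
  by apply: le; rewrite divn_gt0 // dvdn_leq // ?muln_gt0 ?fact_gt0 // dvdn_mulr // dvdn_fact.
by rewrite /modulus; lia.
Qed.

(** A common prime factor would exceed [B] and make [i + 1] and [j + 1] congruent. *)
Lemma modulus_coprime B i j : 2 < B -> i < B -> j < B -> i <> j ->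
  coprime (modulus (B`! * B`!) i) (modulus (B`! * B`!) j).
Proof.
move=> B2 iB jB ij; rewrite /coprime.
set g := gcdn _ _; have g0 : 0 < g.
  by rewrite gcdn_gt0; have := modulus_gt1 B2 iB; lia.
case: (ltngtP g 1) => // [|g1]; first lia.
have pp := pdiv_prime g1; have pg := pdiv_dvd g.
have [Bp E1] := modulus_prime iB pp (dvdn_trans pg (dvdn_gcdl _ _)).
have [_ E2] := modulus_prime jB pp (dvdn_trans pg (dvdn_gcdr _ _)).
by move: E2; rewrite E1 !modn_small; lia.
Qed.

Lemma modulus_prod B n : n <= B ->
  'C((B`! * B`!).-1, n) = \prod_(k < n) modulus (B`! * B`!) k.
Proof.
elim: n => [|n IH] nB; first by rewrite bin0 big_ord0.
rewrite big_ord_recr /= -IH; last exact: ltnW.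
have [_ Et] := modulus_fact nB.
apply/eqP; rewrite -(eqn_pmul2l (ltn0Sn n)) mul_bin_left; apply/eqP.
rewrite mulnCA /modulus mulnBr Et mulnC; congr (_ * _); lia.
Qed.

(** * Coding a bounded quantifier by Chinese remainders *)

Fixpoint nwit (p : pexp) : nat :=
  match p with
  | Wit i => i.+1
  | Add p q | Mul p q => maxn (nwit p) (nwit q)
  | _ => 0
  end.

Lemma peval_congr m d e e' w w' p : nwit p <= m ->
  (forall i, e i = e' i %[mod d]) -> (forall i, i < m -> w i = w' i %[mod d]) ->
  peval e w p = peval e' w' p %[mod d].
Proof.
move=> + He Hw; elim: p => //= p IHp q IHq.
  by rewrite geq_max => /andP[/IHp Hp /IHq Hq]; rewrite -modnDm Hp Hq modnDm.
by rewrite geq_max => /andP[/IHp Hp /IHq Hq]; rewrite -modnMm Hp Hq modnMm.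
Qed.

Lemma peval_mono m e e' w w' p : nwit p <= m ->
  (forall i, e i <= e' i) -> (forall i, i < m -> w i <= w' i) ->
  peval e w p <= peval e' w' p.
Proof.
move=> + He Hw; elim: p => //= p IHp q IHq.
  by rewrite geq_max => /andP[/IHp Hp /IHq Hq]; rewrite leq_add.
by rewrite geq_max => /andP[/IHp Hp /IHq Hq]; rewrite leq_mul.
Qed.

Definition scons (x : nat) (e : nat -> nat) (i : nat) : nat :=
  if i is j.+1 then e j else x.

(** Dominates both sides for indices up to [n] and witnesses up to [u]; the [3] gives [B > 2] and
    [B > u + 1]. *)
Definition pbound (P Q : pexp) (n u : nat) (e : nat -> nat) : nat :=
  peval (scons n e) (fun=> u) P + peval (scons n e) (fun=> u) Q + n + u + 3.

(** [M] is the product of the [n] moduli, and [t = B!^2 - 1] is congruent to [k] modulo the [k]-th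
    one. The residue of [a i] there is meant to be the [i]-th witness for [k]; [M | C(a i, u + 1)]
    keeps it at most [u] modulo any prime factor. *)
Definition bounded_code (P Q : pexp) (m n : nat) (e : nat -> nat) : Prop :=
  exists u F t M, F = (pbound P Q n u e)`! /\ F * F = t.+1 /\ M = 'C(t, n) /\
  exists a : nat -> nat,
    congr_mod M (peval (scons t e) a P) (peval (scons t e) a Q) /\
    forall i, i < m -> u < a i /\ exists c, c = 'C(a i, u.+1) /\ M %| c.

Lemma prime_dvd_ffact p a n : prime p -> n <= a -> p %| a ^_ n ->
  exists2 j, j < n & p %| a - j.
Proof.
move=> pp; elim: n => [|n IH] na; first by rewrite ffactn0 dvdn1 => /eqP p1; move: pp; rewrite p1.
rewrite ffactnSr Euclid_dvdM // => /orP[|d]; last by exists n.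
by move=> /(IH (ltnW na))[j jn d]; exists j => //; lia.
Qed.

(** One prime factor [p] of the [k]-th modulus is enough: at the residues of [a] modulo [p] both
    sides are below [B < p] and congruent modulo [p], hence equal. *)
Lemma bounded_code_forall P Q m n e : nwit P <= m -> nwit Q <= m ->
  bounded_code P Q m n e -> forall k, k < n ->
  exists w, peval (scons k e) w P = peval (scons k e) w Q.
Proof.
move=> Pm Qm [u [F [t [M [EF [Et [EM [a [/congr_modP cPQ Ha]]]]]]]]] k kn.
have [B EB] : exists B, B = pbound P Q n u e by eexists.
rewrite -EB in EF.
have nB : n <= B by rewrite EB /pbound; lia.
have B2 : 2 < B by rewrite EB /pbound; lia.
have kB : k < B by exact: leq_trans kn nB.
have tE : t = (B`! * B`!).-1 by rewrite -EF Et.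
have ME : M = \prod_(k < n) modulus (B`! * B`!) k by rewrite EM tE modulus_prod.
have m1 := modulus_gt1 B2 kB.
have [p pp pd] : exists2 p, prime p & p %| modulus (B`! * B`!) k.
  by exists (pdiv (modulus (B`! * B`!) k)); [exact: pdiv_prime | exact: pdiv_dvd].
have [Bp tk] := modulus_prime kB pp pd.
have pM : p %| M.
  by rewrite ME; apply: dvdn_trans pd _; rewrite (bigD1 (Ordinal kn)) //= dvdn_mulr.
have wu i : i < m -> a i %% p <= u.
  move=> im; have [ua [_ [-> Mc]]] := Ha i im.
  have /(prime_dvd_ffact pp ua)[j ju d] : p %| a i ^_ u.+1.
    by rewrite -bin_ffact dvdn_mulr // (dvdn_trans pM).
  case/dvdnP: d => c Hc; have -> : a i = c * p + j by clear -Hc ju ua; lia.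
  by rewrite modnMDl modn_small; [lia | clear -Bp ju EB; rewrite EB /pbound in Bp; lia].
exists (fun i => a i %% p).
have tk' : t = k %[mod p].
  apply/eqP; rewrite -(eqn_modDr 1) addn1 addn1 -Et EF.
  exact/eqP.
have ev r : nwit r <= m -> peval (scons k e) (fun i => a i %% p) r =
    peval (scons t e) a r %[mod p].
  move=> rm; apply: (peval_congr rm) => [[|i] | i _] //=; by rewrite ?tk' ?modn_mod.
have lt r : nwit r <= m -> peval (scons k e) (fun i => a i %% p) r <=
    peval (scons n e) (fun=> u) r.
  by move=> rm; apply: (peval_mono rm) => [[|i] | i] //=; [exact: ltnW | exact: wu].
have ltp r : peval (scons n e) (fun=> u) r < B -> nwit r <= m ->
    peval (scons k e) (fun i => a i %% p) r %% p = peval (scons k e) (fun i => a i %% p) r.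
  by move=> rB rm; rewrite modn_small // (leq_ltn_trans (lt r rm)) // (ltn_trans rB).
rewrite -(ltp P) //; last by rewrite EB /pbound; clear; lia.
rewrite -(ltp Q) //; last by rewrite EB /pbound; clear; lia.
rewrite (ev _ Pm) (ev _ Qm).
by rewrite -(modn_dvdm _ pM) cPQ modn_dvdm.
Qed.

Lemma forall_bounded_code P Q m n e : nwit P <= m -> nwit Q <= m ->
  (forall k, k < n -> exists w, peval (scons k e) w P = peval (scons k e) w Q) ->
  bounded_code P Q m n e.
Proof.
move=> Pm Qm /(@finite_choice _ _ n (fun=> 0))[W HW].
have [u Wu] : exists u, forall k i, k < n -> i < m -> W k i <= u.
  exists (\max_(k < n) \max_(i < m) W k i) => k i kn im.
  apply: leq_trans (leq_bigmax (Ordinal kn)) => /=.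
  exact: (leq_bigmax (Ordinal im)).
have [B EB] : exists B, B = pbound P Q n u e by eexists.
have nB : n <= B by rewrite EB /pbound; lia.
have B2 : 2 < B by rewrite EB /pbound; lia.
have uB : u.+1 < B by rewrite EB /pbound; lia.
have [mo Emo] : exists mo, mo = modulus (B`! * B`!) by eexists.
have f0 := fact_gt0 B.
have Et : B`! * B`! = (B`! * B`!).-1.+1 by rewrite prednK // muln_gt0 f0.
have cop i j : i < n -> j < n -> i <> j -> coprime (mo i) (mo j).
  by move=> *; rewrite Emo; apply: modulus_coprime => //; exact: leq_trans nB.
have mo1 k : k < n -> 1 < mo k by move=> kn; rewrite Emo; apply: modulus_gt1 => //; exact: leq_trans nB.
have [M EM] : exists M, M = \prod_(k < n) mo k by eexists.
have M0 : 0 < M by rewrite EM prodn_gt0 // => k; exact: ltnW (mo1 k (ltn_ord k)).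
have moM k : k < n -> mo k %| M.
  by move=> kn; rewrite EM (bigD1 (Ordinal kn)) //= dvdn_mulr.
have [a Ha] : exists a : nat -> nat, forall i, i < m ->
    u < a i /\ forall k, k < n -> a i = W k i %[mod mo k].
  apply: (@finite_choice _ (fun i x =>
    u < x /\ forall k, k < n -> x = W k i %[mod mo k]) m 0) => i im.
  have [x Hx] := chinese_exists (fun k => W k i) cop.
  (* The multiple of [M] changes no residue and forces [u < a i]. *)
  exists (u.+1 * M + x); split; first by apply: leq_trans (leq_addr _ _); exact: leq_pmulr.
  move=> k kn; rewrite -modnDml -modnMmr (eqP (moM k kn)) muln0 mod0n add0n; exact: Hx.
exists u, B`!, (B`! * B`!).-1, M; split; first by rewrite EB.
split; first exact: Et.
split; first by rewrite EM Emo modulus_prod.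
exists a; split.
  apply/congr_modP; rewrite EM; apply: chinese_prod => // k kn.
  have tk : (B`! * B`!).-1 = k %[mod mo k].
    have kB : k < B by exact: leq_trans kn nB.
    have [_ E] := modulus_fact kB.
    apply/eqP; rewrite -(eqn_modDr 1) addn1 addn1 -Et -E.
    have -> : (B`! * B`!) %/ k.+1 = mo k + 1.
      by have := mo1 k kn; rewrite Emo /modulus; move: (_ %/ _) => q; clear; lia.
    by rewrite mulnDr muln1 modnMDl.
  have ev r : nwit r <= m ->
      peval (scons (B`! * B`!).-1 e) a r = peval (scons k e) (W k) r %[mod mo k].
    by move=> rm; apply: (peval_congr rm) => [[|i] | i im] //=; have [_ ->] := Ha i im.
  by rewrite (ev _ Pm) (ev _ Qm) HW.
move=> i im; have [ua Hk] := Ha i im; split=> //; eexists; split=> //.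
(* Prime factors of the moduli exceed [B > u + 1], so divisibility passes from the falling factorial
   to the binomial coefficient. *)
have copf k : k < n -> coprime (mo k) (u.+1)`!.
  move=> kn; rewrite /coprime; have g0 : 0 < gcdn (mo k) (u.+1)`! by rewrite gcdn_gt0 fact_gt0 orbT.
  have [g Eg] : exists g, g = gcdn (mo k) (u.+1)`! by eexists.
  rewrite -Eg in g0 *.
  case: (ltngtP g 1) => // [|g1]; first by rewrite ltnS leqNgt g0.
  have pp := pdiv_prime g1; have pg := pdiv_dvd g; have kB : k < B by exact: leq_trans kn nB.
  have d1 := pg; rewrite {2}Eg dvdn_gcd Emo in d1; case/andP: d1 => d1 d2.
  have [Bp _] := modulus_prime kB pp d1.
  move: d2; rewrite -ffactnn.
  by move: (pdiv g) Bp pp => p Bp pp /(prime_dvd_ffact pp (leqnn _))[j ju /dvdn_leq];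
    clear -ju uB Bp; lia.
suff /eqP : 'C(a i, u.+1) = 0 %[mod M] by rewrite mod0n.
rewrite EM; apply: chinese_prod => // k kn; rewrite mod0n; apply/eqP.
rewrite -/(_ %| _) -(Gauss_dvdl _ (copf k kn)) bin_ffact ffact_prod.
have Wk := Wu k i kn im; have Wlt : W k i < u.+1 by [].
rewrite (bigD1 (Ordinal Wlt)) //= dvdn_mulr // -eqn_mod_dvd; last exact: leq_trans Wk (ltnW ua).
by apply/eqP; exact: Hk.
Qed.


Lemma poly_peval_scons p f (r : nat -> nat) (g : nat -> (nat -> nat) -> nat)
    (s : nat -> pexp) :
  poly f -> (forall i e w, g i e = peval e w (s i)) ->
  poly (fun e => peval (scons (f e) (fun i => e (r i))) (fun i => g i e) p).
Proof.
move=> [pf Hf] Hg.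
exists (psubst (fun i => if i is j.+1 then Par (r j) else pf) s p) => e w.
rewrite peval_subst; congr peval; apply: functional_extensionality => [[|i]] //=.
Qed.

Lemma dioph_bounded_code P Q m f : poly f ->
  dioph (fun e => bounded_code P Q m (f e) e).
Proof.
move=> Hf; do 4 apply: dioph_ex.
apply: dioph_and.
  apply: dioph_factorial; first by poly_tac.
  rewrite /pbound; do 3 (apply: poly_add; last by poly_tac); apply: poly_add.
    apply: (@poly_peval_scons P _ (fun i => i.+4) (fun i e => e 3) (fun=> Par 3)) => //.
    by poly_tac.
  apply: (@poly_peval_scons Q _ (fun i => i.+4) (fun i e => e 3) (fun=> Par 3)) => //.
  by poly_tac.
apply: dioph_and; first by dio.
apply: dioph_and; first by apply: dioph_binomial; poly_tac.
apply: dioph_exenv; apply: dioph_and.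
  apply: dioph_congr_mod; first by poly_tac.
    by apply: (@poly_peval_scons P _ (fun i => i.+4.*2.+1)
      (fun i e => e i.*2) (fun i => Par i.*2)) => //; poly_tac.
  by apply: (@poly_peval_scons Q _ (fun i => i.+4.*2.+1)
      (fun i e => e i.*2) (fun i => Par i.*2)) => //; poly_tac.
apply: dioph_all_ltn => i _; apply: dioph_and; first by dio.
apply: dioph_ex; apply: dioph_and; last by dio.
by apply: dioph_binomial; poly_tac.
Qed.

Lemma dioph_forall (R : nat -> (nat -> nat) -> Prop) f :
  dioph (fun e => R (e 0) (fun i => e i.+1)) -> poly f ->
  dioph (fun e => forall k, k < f e -> R k e).
Proof.
move=> [P [Q H]] Hf; pose m := maxn (nwit P) (nwit Q).
have [Pm Qm] : nwit P <= m /\ nwit Q <= m by rewrite leq_maxl leq_maxr.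
apply: dioph_ext (dioph_bounded_code P Q m Hf) => e.
have HR k : R k e <-> exists w, peval (scons k e) w P = peval (scons k e) w Q.
  exact: (H (scons k e)).
split=> [C k kn | HRk].
  by apply/HR; exact: bounded_code_forall C k kn.
by apply: forall_bounded_code => // k kn; apply/HR/HRk.
Qed.

(** * Recursive functions *)

(** Supplies hypotheses for the functions in the list under [rComp] as well. *)
Lemma recf_nested_ind (T : recf -> Prop) :
  T rZero -> T rSucc -> (forall i, T (rProj i)) ->
  (forall f gs, T f -> (forall i, i < size gs -> T (nth rZero gs i)) -> T (rComp f gs)) ->
  (forall f g, T f -> T g -> T (rPrim f g)) -> (forall f, T f -> T (rMu f)) ->
  forall f, T f.
Proof.
move=> H0 HS Hp Hc Hr Hm; fix IH 1; case=> [||i|f gs|f g|f].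
- exact: H0.
- exact: HS.
- exact: Hp.
- refine (Hc f gs (IH f) _); elim: gs => [|g gs IHgs] i.
    rewrite nth_nil => _; exact: H0.
  case: i => [_ | i isz]; [exact: (IH g) | exact: (IHgs i isz)].
- exact: Hr (IH f) (IH g).
- exact: Hm (IH f).
Qed.

Lemma reval_proj i v y : reval (rProj i) v y -> i < size v /\ y = nth 0 v i.
Proof. by move=> H; inversion H. Qed.

Lemma revals_nth gs v ws : revals gs v ws <->
  size ws = size gs /\ forall i, i < size gs -> reval (nth rZero gs i) v (nth 0 ws i).
Proof.
split=> [|[]].
  by elim: gs ws => [|g gs IH] ws H; inversion H; subst => //=;
     have [-> Hn] := IH _ H5; split=> // -[|i] //= ?; apply: Hn.
elim: gs ws => [|g gs IH] [|w ws] //= => [*|[sz] Hn]; first by constructor.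
constructor; first exact: (Hn 0).
by apply: IH => // i isz; exact: (Hn i.+1).
Qed.

Lemma reval_comp f gs v y : reval (rComp f gs) v y <->
  exists a : nat -> nat, reval f [seq a i | i <- iota 0 (size gs)] y /\
    forall i, i < size gs -> reval (nth rZero gs i) v (a i).
Proof.
split=> [H | [a [Hf Ha]]].
  inversion H; subst; have /revals_nth[sz Hn] := H2.
  exists (nth 0 ws); split=> //.
  by rewrite -sz -[[seq _ | _ <- _]]/(mkseq (nth 0 ws) (size ws)) mkseq_nth.
apply: ev_comp Hf; apply/revals_nth; split; first by rewrite size_map size_iota.
by move=> i isz; rewrite (nth_map 0) ?size_iota // nth_iota //; exact: Ha.
Qed.

Lemma reval_prim f g n v y : reval (rPrim f g) (n :: v) y <->
  exists z : nat -> nat, reval f v (z 0) /\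
    (forall i, i < n -> reval g (i :: z i :: v) (z i.+1)) /\ z n = y.
Proof.
split.
  elim: n y => [|n IH] y H; inversion H; subst; first by exists (fun=> y).
  have [s [z0 [zS zn]]] := IH _ H5.
  exists (fun i => if i == n.+1 then y else s i); split=> //; split; last by rewrite eqxx.
  move=> i; rewrite ltnS => iN; rewrite ltn_eqF // eqSS.
  case: eqVneq => [-> | neq]; first by rewrite zn.
  by apply: zS; rewrite ltn_neqAle neq.
elim: n y => [|n IH] y [z [z0 [zS <-]]]; first exact: ev_prim0.
apply: (@ev_primS _ _ _ _ (z n)); last exact: zS.
by apply: IH; exists z; split=> //; split=> // i iN; apply: zS; exact: ltnW.
Qed.

(** The history of the recursion becomes the base-[r] digits of one number, leaving numerical
    quantifiers and one bounded universal quantifier. *)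
Lemma reval_prim_digit f g n v y : reval (rPrim f g) (n :: v) y <->
  exists c r z0, digit c r 0 z0 /\ reval f v z0 /\ digit c r n y /\
    forall i, i < n -> exists z z',
      digit c r i z /\ digit c r i.+1 z' /\ reval g (i :: z :: v) z'.
Proof.
rewrite reval_prim; split=> [[z [z0 [zS <-]]] | [c [r [z0 [D0 [H0 [Dn HS]]]]]]].
  pose r := (\max_(i < n.+1) z i).+1.
  have D i : i < n.+1 -> digit (\sum_(j < n.+1) z j * r ^ j) r i (z i).
    apply: digit_sum => j jn; rewrite ltnS.
    exact: (@leq_bigmax _ (fun i : 'I_n.+1 => z i) (Ordinal jn)).
  exists (\sum_(j < n.+1) z j * r ^ j), r, (z 0).
  split; first exact: D; split=> //; split; first exact: D.
  move=> i iN; exists (z i), (z i.+1).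
  by split; [apply: D; exact: ltnW | split; [exact: D | exact: zS]].
exists (fun i => c %/ r ^ i %% r).
have dE i x : digit c r i x -> c %/ r ^ i %% r = x by move=> /digitP[].
rewrite (dE _ _ D0) (dE _ _ Dn); split=> //; split=> // i iN.
by have [z [z' [/dE -> [/dE -> H]]]] := HS i iN.
Qed.

Lemma reval_mu f v n : reval (rMu f) v n <->
  reval f (n :: v) 0 /\ forall m, m < n -> exists k, reval f (m :: v) k.+1.
Proof. by split=> [H | [? ?]]; [inversion H | exact: ev_mu]. Qed.

Lemma reval_inj f v y y' : reval f v y -> reval f v y' -> y = y'.
Proof.
elim/recf_nested_ind: f v y y' => [||i|f gs IHf IHgs|f g IHf IHg|f IHf] v y y'.
- by move=> H H'; inversion H; inversion H'.
- by move=> H H'; inversion H; subst; inversion H'.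
- by move=> H H'; inversion H; inversion H'.
- move=> /reval_comp[a [Ha Hga]] /reval_comp[b [Hb Hgb]].
  apply: IHf Ha _; suff -> : [seq a i | i <- iota 0 (size gs)] =
    [seq b i | i <- iota 0 (size gs)] by [].
  apply/eq_in_map => i; rewrite mem_iota add0n => /= isz.
  exact: IHgs isz _ _ _ (Hga i isz) (Hgb i isz).
- case: v => [|n v]; first by move=> H; inversion H.
  move=> /reval_prim[z [z0 [zS <-]]] /reval_prim[z' [z0' [zS' <-]]].
  suff: forall i, i <= n -> z i = z' i by apply.
  elim=> [|i IHi] iN; first exact: IHf z0 z0'.
  by have := zS i iN; rewrite (IHi (ltnW iN)) => H; exact: IHg H (zS' i iN).
- move=> /reval_mu[H0 Hlt] /reval_mu[H0' Hlt'].
  case: (ltngtP y y') => // [/Hlt'[k Hk] | /Hlt[k Hk]].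
    by have := IHf _ _ _ H0 Hk.
  by have := IHf _ _ _ H0' Hk.
Qed.

Lemma dioph_false : dioph (fun=> False).
Proof. by apply: dioph_ext (dioph_eq (poly_cst 0) (poly_cst 1)). Qed.

(** [vs] and [y] are positions in the valuation, so the induction hypotheses apply wherever new
    quantifiers move the arguments. *)
Lemma dioph_reval f (vs : seq nat) y : dioph (fun e => reval f (map e vs) (e y)).
Proof.
elim/recf_nested_ind: f vs y => [||i|f gs IHf IHgs|f g IHf IHg|f IHf] vs y.
- apply: (@dioph_ext (fun e => e y = 0)); last by dio.
  by move=> e; split=> [-> | H]; [constructor | inversion H].
- case: vs => [|x vs].
    by apply: dioph_ext dioph_false => e; split=> // H; inversion H.
  apply: (@dioph_ext (fun e => e y = (e x).+1)); last by dio.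
  by move=> e; split=> [-> | H]; [constructor | inversion H].
- have [le | lt] := leqP (size vs) i.
    apply: dioph_ext dioph_false => e; split=> // /reval_proj[].
    by rewrite size_map ltnNge le.
  apply: (@dioph_ext (fun e => e y = e (nth 0 vs i))); last by dio.
  move=> e; rewrite -(nth_map 0 0 e lt); split=> [-> | H]; last by inversion H.
  by constructor; rewrite size_map.
- apply: dioph_ext (fun e => iff_sym (reval_comp f gs (map e vs) (e y))) _.
  apply: dioph_exenv; apply: dioph_and.
    apply: dioph_ext (IHf (map double (iota 0 (size gs))) y.*2.+1) => e.
    by rewrite -map_comp.
  apply: dioph_all_ltn => i isz.
  by apply: dioph_ext (IHgs i isz (map (fun j => j.*2.+1) vs) i.*2) => e; rewrite -map_comp.
- case: vs => [|n vs].
    by apply: dioph_ext dioph_false => e; split=> // H; inversion H.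
  apply: dioph_ext (fun e => iff_sym (reval_prim_digit f g (e n) (map e vs) (e y))) _.
  do 3 apply: dioph_ex; apply: dioph_and; first by apply: dioph_digit; poly_tac.
  apply: dioph_and.
    by apply: dioph_ext (IHf (map (fun i => i.+3) vs) 0) => e; rewrite -map_comp.
  apply: dioph_and; first by apply: dioph_digit; poly_tac.
  apply: dioph_forall; last by poly_tac.
  do 2 apply: dioph_ex; apply: dioph_and; first by apply: dioph_digit; poly_tac.
  apply: dioph_and; first by apply: dioph_digit; poly_tac.
  apply: dioph_ext (IHg [:: 2, 1 & map (fun i => i.+3.+3) vs] 0) => e.
  by rewrite /= -map_comp.
- apply: dioph_ext (fun e => iff_sym (reval_mu f (map e vs) (e y))) _.
  apply: dioph_and.
    apply: (@dioph_ext (fun e => exists z, z = 0 /\ reval f (e y :: map e vs) z)).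
      by move=> e; split=> [[z [-> //]] | H]; exists 0.
    apply: dioph_ex; apply: dioph_and; first by dio.
    by apply: dioph_ext (IHf (y.+1 :: map succn vs) 0) => e; rewrite /= -map_comp.
  apply: dioph_forall; last by poly_tac.
  apply: (@dioph_ext (fun e => exists k z, z = k.+1 /\
      reval f (e 0 :: [seq e i.+1 | i <- vs]) z)).
    move=> e; split=> [[k [z [-> H]]] | [k H]]; first by exists k.
    by exists k, k.+1.
  do 2 apply: dioph_ex; apply: dioph_and; first by dio.
  by apply: dioph_ext (IHf (2 :: map (fun i => i.+3) vs) 0) => e; rewrite /= -map_comp.
Qed.

(** * Sums of four squares *)

Definition sum4sq (z : Z) : Prop :=
  exists a b c d : Z, z = (a * a + b * b + c * c + d * d)%Z.

(** Euler's identity, the multiplicativity of the quaternion norm. *)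
Lemma sum4sq_mul x y : sum4sq x -> sum4sq y -> sum4sq (x * y)%Z.
Proof.
move=> [a [b [c [d ->]]]] [a' [b' [c' [d' ->]]]].
exists (a * a' + b * b' + c * c' + d * d')%Z, (a * b' - b * a' + c * d' - d * c')%Z,
  (a * c' - c * a' + d * b' - b * d')%Z, (a * d' - d * a' + b * c' - c * b')%Z.
ring.
Qed.

Lemma sqr_mod_inj p x x' : prime p -> x < x' -> x + x' < p ->
  x * x <> x' * x' %[mod p].
Proof.
move=> pp lt xx' E.
have /eqP : x' * x' = x * x %[mod p] by [].
rewrite eqn_mod_dvd; last by nia.
have -> : x' * x' - x * x = (x' - x) * (x' + x) by nia.
by rewrite Euclid_dvdM // => /orP[] /dvdn_leq; lia.
Qed.

(* Pigeonhole: the [p./2.+1] squares and the [p./2.+1] values [-1 - y^2]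
   cannot all be distinct modulo [p]. *)
Lemma neg1_sum2sq_mod p : prime p -> odd p ->
  exists x y m, x * x + y * y + 1 = m * p /\ 0 < m < p.
Proof.
move=> pp op; pose h := p./2; have p1 := prime_gt1 pp.
have Ep : p = h.*2.+1 by rewrite -[LHS]odd_double_half op.
have [/existsP[x /existsP[y]] | none] :=
    boolP [exists x : 'I_h.+1, exists y : 'I_h.+1, p %| x * x + y * y + 1].
  move=> /dvdnP[m Em]; exists x, y, m; split=> //.
  have xh := ltn_ord x; have yh := ltn_ord y.
  have : x * x + y * y + 1 < p * p by rewrite Ep; nia.
  by rewrite Em ltn_pmul2r ?(ltnW p1) // => ->; case: m Em => // Em; lia.
have p0 : 0 < p by lia.
(* [rev_ord] sends a residue [r] to [p - 1 - r], here [-1 - y^2]. *)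
pose f (z : 'I_h.+1 + 'I_h.+1) : 'I_p := match z with
  | inl x => Ordinal (ltn_pmod (x * x) p0)
  | inr y => rev_ord (Ordinal (ltn_pmod (y * y) p0))
  end.
have sq_inj (x x' : 'I_h.+1) : x * x = x' * x' %[mod p] -> x = x'.
  move=> E; have xh := ltn_ord x; have xh' := ltn_ord x'.
  case: (ltngtP x x') => [lt | lt | /val_inj //].
    by case: (@sqr_mod_inj p x x' pp lt _ E); lia.
  by case: (@sqr_mod_inj p x' x pp lt _ (esym E)); lia.
have no (x y : 'I_h.+1) : f (inl x) <> f (inr y).
  move=> /(congr1 val) /= E; case/existsP: none; exists x; apply/existsP; exists y.
  have ly : (y * y) %% p < p by rewrite ltn_mod.
  apply/dvdnP; exists (x * x %/ p + y * y %/ p + 1).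
  rewrite [X in X + _ + 1](divn_eq _ p) [X in _ + X + 1](divn_eq _ p) E.
  by move: (_ %/ _) (_ %/ _) (_ %% _) ly => q q' r; lia.
have /leq_card : injective f.
  move=> [x|y] [x'|y'].
  - by move=> /(congr1 val) /= /sq_inj ->.
  - by move=> /no.
  - by move=> /esym/no.
  - by move=> /rev_ord_inj /(congr1 val) /= /sq_inj ->.
by rewrite card_sum !card_ord Ep; lia.
Qed.

Section Descent.

Local Open Scope Z_scope.

Lemma centered_residue x m : 0 < m -> exists k, - m <= 2 * (x - m * k) <= m.
Proof.
move=> m0; exists ((2 * x + m) / (2 * m)).
have := Z.div_mod (2 * x + m) (2 * m); have := Z.mod_pos_bound (2 * x + m) (2 * m).
by move: ((2 * x + m) / (2 * m)) ((2 * x + m) mod (2 * m)) => q r; lia.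
Qed.

Lemma sqr_le_bound y m : - m <= 2 * y <= m -> 4 * (y * y) <= m * m.
Proof. by move=> ?; nia. Qed.

Lemma sqr_eq_bound y m : 4 * (y * y) = m * m -> 2 * y = m \/ 2 * y = - m.
Proof.
move=> E; have /Z.mul_eq_0 : (2 * y - m) * (2 * y + m) = 0 by lia.
by lia.
Qed.

(* If [x - m k = - m / 2 or m / 2] then [x = m / 2 + m k'], whose square is
   [m^2 / 4 + m^2 k' (k' + 1)]. *)
Lemma half_residue_sqr x m k : 4 * ((x - m * k) * (x - m * k)) = m * m ->
  exists c, 4 * (x * x) = m * m + 4 * (m * m * c).
Proof.
move=> /sqr_eq_bound[E | E].
  exists (k * (k + 1)); have E' : 2 * x = m * (2 * k + 1) by lia.
  by transitivity ((2 * x) * (2 * x)); [ring | rewrite E'; ring].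
exists (k * (k - 1)); have E' : 2 * x = m * (2 * k - 1) by lia.
by transitivity ((2 * x) * (2 * x)); [ring | rewrite E'; ring].
Qed.

(** Lagrange's descent: the squares of the centred residues of the [x_i] modulo [m] sum to [m r]
    with [0 <= r <= m], and either extreme value of [r] would make [m] divide [p]. *)
Lemma sum4sq_descent p m : (forall c, p = m * c -> False) -> 1 < m -> 0 < p ->
  sum4sq (m * p) -> exists r, 0 < r < m /\ sum4sq (r * p).
Proof.
move=> np m1 p0 [x1 [x2 [x3 [x4 E]]]].
have m0 : 0 < m by lia.
have [k1 b1] := centered_residue x1 m0; have [k2 b2] := centered_residue x2 m0.
have [k3 b3] := centered_residue x3 m0; have [k4 b4] := centered_residue x4 m0.
pose S := x1 * k1 + x2 * k2 + x3 * k3 + x4 * k4.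
pose K := k1 * k1 + k2 * k2 + k3 * k3 + k4 * k4.
pose r := p - 2 * S + m * K.
have Er : m * r = (x1 - m * k1) * (x1 - m * k1) + (x2 - m * k2) * (x2 - m * k2)
   + (x3 - m * k3) * (x3 - m * k3) + (x4 - m * k4) * (x4 - m * k4).
  transitivity (m * p - 2 * m * S + m * m * K); first by rewrite /r; ring.
  by rewrite E /S /K; ring.
have h1 := sqr_le_bound b1; have h2 := sqr_le_bound b2.
have h3 := sqr_le_bound b3; have h4 := sqr_le_bound b4.
have g1 := Z.square_nonneg (x1 - m * k1); have g2 := Z.square_nonneg (x2 - m * k2).
have g3 := Z.square_nonneg (x3 - m * k3); have g4 := Z.square_nonneg (x4 - m * k4).
exists r; split; last first.
  (* Euler's product of the [x_i] with their residues [x_i - m k_i], divided by [m], up to signs. *)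
  exists (p - S), (x1 * k2 - x2 * k1 + x3 * k4 - x4 * k3),
    (x1 * k3 - x3 * k1 + x4 * k2 - x2 * k4), (x1 * k4 - x4 * k1 + x2 * k3 - x3 * k2).
  transitivity (p * p - 2 * p * S + (m * p) * K); first by rewrite /r; ring.
  by rewrite E /S /K; ring.
have r0 : 0 <= r by nia.
have rm : r <= m by nia.
have rn0 : r <> 0.
  move=> rz; rewrite rz Z.mul_0_r in Er.
  have z y : y * y = 0 -> y = 0 by nia.
  have e1 := z (x1 - m * k1); have e2 := z (x2 - m * k2).
  have e3 := z (x3 - m * k3); have e4 := z (x4 - m * k4).
  have {}e1 : x1 = m * k1 by lia.
  have {}e2 : x2 = m * k2 by lia.
  have {}e3 : x3 = m * k3 by lia.
  have {}e4 : x4 = m * k4 by lia.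
  apply: (np K); apply: (Z.mul_reg_l _ _ m); first lia.
  by rewrite E e1 e2 e3 e4 /K; ring.
have rnm : r <> m.
  move=> rz; rewrite rz in Er.
  have [|c1 q1] := @half_residue_sqr x1 m k1; first by lia.
  have [|c2 q2] := @half_residue_sqr x2 m k2; first by lia.
  have [|c3 q3] := @half_residue_sqr x3 m k3; first by lia.
  have [|c4 q4] := @half_residue_sqr x4 m k4; first by lia.
  apply: (np (1 + c1 + c2 + c3 + c4)); apply: (Z.mul_reg_l _ _ m); first lia.
  by lia.
lia.
Qed.

End Descent.

Lemma prime_sum4sq p : prime p -> sum4sq (Z.of_nat p).
Proof.
move=> pp; have p1 := prime_gt1 pp.
case: (even_prime pp) => [-> | op]; first by exists 1%Z, 1%Z, 0%Z, 0%Z.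
have [x [y [m [E /andP[m0 mp]]]]] := neg1_sum2sq_mod pp op.
have : sum4sq (Z.of_nat m * Z.of_nat p).
  by exists (Z.of_nat x), (Z.of_nat y), 1%Z, 0%Z; lia.
elim/ltn_ind: m m0 mp {x y E} => m IH m0 mp S.
have [m1 | m1] := leqP m 1; first by move: S; rewrite (_ : m = 1) ?Z.mul_1_l //; lia.
have [||||r [rm Sr]] := @sum4sq_descent (Z.of_nat p) (Z.of_nat m) => //; try lia.
  move=> c Ec; have /dvdnZ md : (Z.of_nat m | Z.of_nat p)%Z by exists c; lia.
  by have /primeP[_ /(_ m md)/orP[] /eqP] := pp; lia.
apply: (IH (Z.to_nat r)); try lia.
by rewrite Z2Nat.id //; lia.
Qed.

Lemma nat_sum4sq n : sum4sq (Z.of_nat n).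
Proof.
elim/ltn_ind: n => n IH; have [n1 | n1] := leqP n 1.
  case: n n1 {IH} => [|[|n]] // _; first by exists 0%Z, 0%Z, 0%Z, 0%Z.
  by exists 1%Z, 0%Z, 0%Z, 0%Z.
have pp := pdiv_prime n1; rewrite -(divnK (pdiv_dvd n)) Nat2Z.inj_mul.
apply: sum4sq_mul; last exact: prime_sum4sq.
by apply: IH; rewrite ltn_Pdiv ?prime_gt1 //; lia.
Qed.

(** * Words over the group *)

Lemma eqG_refl u : eqG u u. Proof. exact: rst_refl. Qed.
Lemma eqG_sym u v : eqG u v -> eqG v u. Proof. exact: rst_sym. Qed.
Lemma eqG_trans v u w : eqG u v -> eqG v w -> eqG u w. Proof. exact: rst_trans. Qed.

Lemma eqG_ctx x y u v : eqG u v -> eqG (x ++ u ++ y) (x ++ v ++ y).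
Proof.
elim=> [{}u {}v H | | | ]; last 3 first.
- by move=> ?; exact: eqG_refl.
- by move=> ? ? _; exact: eqG_sym.
- by move=> ? ? ? _ H1 _; exact: eqG_trans.
apply: rst_step; case: H => [u' v' e z | u' v' r rin].
  by have := gstep_red (x ++ u') (v' ++ y) e z; rewrite -!catA.
by have := gstep_rel (x ++ u') (v' ++ y) rin; rewrite -!catA.
Qed.

Lemma eqG_cat u u' v v' : eqG u u' -> eqG v v' -> eqG (u ++ v) (u' ++ v').
Proof.
move=> Hu Hv; apply: (@eqG_trans (u' ++ v)); first exact: (@eqG_ctx [::] v).
by have := eqG_ctx u' [::] Hv; rewrite !cats0.
Qed.

Lemma ginv_cat u v : ginv (u ++ v) = ginv v ++ ginv u.
Proof. by rewrite /ginv map_cat rev_cat. Qed.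

Lemma ginvK : involutive ginv.
Proof.
move=> u; rewrite /ginv map_rev revK -map_comp -[RHS]map_id.
by apply: eq_map => -[e x] /=; rewrite negbK.
Qed.

Lemma eqG_mulV u : eqG (u ++ ginv u) [::].
Proof.
elim: u => [|[e x] u IH]; first exact: eqG_refl.
rewrite -cat1s ginv_cat -catA (catA u).
apply: (@eqG_trans ([:: (e, x)] ++ [::] ++ [:: (~~ e, x)])); first exact: eqG_ctx.
exact: rst_step (gstep_red [::] [::] e x).
Qed.

Lemma eqG_mulVl u : eqG (ginv u ++ u) [::].
Proof. by have := eqG_mulV (ginv u); rewrite ginvK. Qed.

Lemma eqG_mulVP u v : eqG (u ++ ginv v) [::] <-> eqG u v.
Proof.
split=> H.
  apply: (@eqG_trans (u ++ ginv v ++ v)).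
    by have := eqG_ctx u [::] (eqG_mulVl v); rewrite !cats0 => /eqG_sym.
  by have := eqG_ctx [::] v H; rewrite -catA.
exact: eqG_trans (eqG_cat H (eqG_refl _)) (eqG_mulV v).
Qed.

Lemma eqG_mulVlP u v : eqG (ginv u ++ v) [::] <-> eqG v u.
Proof.
split=> H.
  apply: (@eqG_trans (u ++ ginv u ++ v)).
    by have := eqG_ctx [::] v (eqG_mulV u); rewrite -!catA => /eqG_sym.
  by have := eqG_ctx u [::] H; rewrite !cats0.
exact: eqG_trans (eqG_cat (eqG_refl _) H) (eqG_mulVl u).
Qed.

Definition commG (u v : gword) : Prop := eqG (u ++ v) (v ++ u).

Lemma commG_sym u v : commG u v -> commG v u. Proof. exact: eqG_sym. Qed.

Lemma commG_refl u : commG u u. Proof. exact: eqG_refl. Qed.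

Lemma commG_nil v : commG [::] v.
Proof. by rewrite /commG cats0; exact: eqG_refl. Qed.

Lemma commG_cat u u' v : commG u v -> commG u' v -> commG (u ++ u') v.
Proof.
move=> H H'; apply: (@eqG_trans (u ++ v ++ u')).
  by rewrite -catA; exact: eqG_cat (eqG_refl _) H'.
by rewrite !catA; exact: eqG_cat H (eqG_refl _).
Qed.

Lemma commG_inv u v : commG u v -> commG (ginv u) v.
Proof.
move=> H; apply: (@eqG_trans (ginv u ++ v ++ u ++ ginv u)).
  have := eqG_ctx (ginv u ++ v) [::] (eqG_mulV u).
  by rewrite !cats0 -!catA => /eqG_sym.
apply: (@eqG_trans (ginv u ++ u ++ v ++ ginv u)).
  by have := eqG_ctx (ginv u) (ginv u) (eqG_sym H); rewrite -!catA.
by have := eqG_ctx [::] (v ++ ginv u) (eqG_mulVl u); rewrite -!catA.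
Qed.

Definition wpow (u : gword) (n : nat) : gword := flatten (nseq n u).

Definition zpow (u : gword) (k : Z) : gword :=
  if (0 <=? k)%Z then wpow u (Z.to_nat k) else wpow (ginv u) (Z.to_nat (- k)).

Lemma commG_wpow u v n : commG u v -> commG (wpow u n) v.
Proof.
by move=> H; elim: n => [|n IH]; [exact: commG_nil | exact: commG_cat].
Qed.

Lemma commG_zpow u v k : commG u v -> commG (zpow u k) v.
Proof.
by move=> H; rewrite /zpow; case: ifP => _; apply: commG_wpow => //; exact: commG_inv.
Qed.

Lemma zpowS u k : eqG (zpow u (1 + k)) (u ++ zpow u k).
Proof.
rewrite /zpow; case: Z.leb_spec => k1; case: Z.leb_spec => k0; try lia.
- rewrite (_ : Z.to_nat (1 + k) = (Z.to_nat k).+1); last lia.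
  exact: eqG_refl.
- have -> : Z.to_nat (1 + k) = 0 by lia.
  have -> : Z.to_nat (- k) = 1 by lia.
  by rewrite /wpow /= cats0; exact: eqG_sym (eqG_mulV u).
- rewrite (_ : Z.to_nat (- k) = (Z.to_nat (- (1 + k))).+1); last lia.
  rewrite /wpow /= catA.
  exact: (@eqG_ctx [::] _ _ _ (eqG_sym (eqG_mulV u))).
Qed.

Lemma zpowP u k : eqG (zpow u (-1 + k)) (ginv u ++ zpow u k).
Proof.
apply: eqG_sym; apply: (@eqG_trans (ginv u ++ u ++ zpow u (-1 + k))).
  apply: eqG_cat; first exact: eqG_refl.
  by have := zpowS u (-1 + k); rewrite (_ : (1 + (-1 + k) = k)%Z) //; lia.
by rewrite catA; exact: (@eqG_ctx [::] _ _ _ (eqG_mulVl u)).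
Qed.

Lemma zpow_nat u n : zpow u (Z.of_nat n) = wpow u n.
Proof. by rewrite /zpow; case: Z.leb_spec => ?; [rewrite Nat2Z.id | lia]. Qed.

(** * A nilpotent quotient *)

(* [F_3 / gamma_3] in (doubled) Lie coordinates: [x, y, z] are the exponents of
   [a, b, c] and [p, q, r] the coordinates along the commutators [b, a], [c, b],
   [c, a].  It is extended by the exponents [s, t] of the stable letters, and
   [o] makes [s, t, o] a Heisenberg group. *)
Record nil2 := Nil2 { nx : Z; ny : Z; nz : Z; np : Z; nq : Z; nr : Z;
                      ns : Z; nt : Z; no : Z }.

(** The stable exponents of [g] act on [h] by sending [a] to [b^t a b^s]. In doubled coordinates
    [ab] has [p = -1] and [ba] has [p = 1], whence the shift by [t - s]; [q] moves with [r] because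
    [[c, a]] picks up [[c, b]^(s+t)]. *)
Definition nil2_mul (g h : nil2) : nil2 :=
  let k := (ns g + nt g)%Z in
  let y := (ny h + k * nx h)%Z in
  let p := (np h + (nt g - ns g) * nx h)%Z in
  let q := (nq h + k * nr h)%Z in
  Nil2 (nx g + nx h) (ny g + y) (nz g + nz h)
    (np g + p + ny g * nx h - nx g * y) (nq g + q + nz g * y - ny g * nz h)
    (nr g + nr h + nz g * nx h - nx g * nz h)
    (ns g + ns h) (nt g + nt h) (no g + no h + ns g * nt h).

Definition nil2_1 : nil2 := Nil2 0 0 0 0 0 0 0 0 0.

Definition nil2_letter (l : bool * gen) : nil2 :=
  let e := (if l.1 then 1 else -1)%Z in
  match val l.2 with
  | 0 => Nil2 e 0 0 0 0 0 0 0 0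
  | 1 => Nil2 0 e 0 0 0 0 0 0 0
  | 2 => Nil2 0 0 e 0 0 0 0 0 0
  | 3 => Nil2 0 0 0 0 0 0 e 0 0
  | _ => Nil2 0 0 0 0 0 0 0 e 0
  end.

Lemma nil2_mulA g h k : nil2_mul g (nil2_mul h k) = nil2_mul (nil2_mul g h) k.
Proof. by rewrite /nil2_mul /=; congr Nil2; ring. Qed.

Lemma nil2_mul1 g : nil2_mul nil2_1 g = g.
Proof. by case: g => *; rewrite /nil2_mul /=; congr Nil2; ring. Qed.

Definition nil2_word (w : gword) : nil2 :=
  foldr (fun l g => nil2_mul (nil2_letter l) g) nil2_1 w.

Lemma nil2_word_cat u v : nil2_word (u ++ v) = nil2_mul (nil2_word u) (nil2_word v).
Proof.
elim: u => [|l u IH] /=; first by rewrite nil2_mul1.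
by rewrite IH nil2_mulA.
Qed.

Lemma eqG_nil2 u v : eqG u v -> nil2_word u = nil2_word v.
Proof.
elim=> [{}u {}v | // | ? ? _ -> | ? ? ? _ -> _ ->] //.
case=> [x y e z | x y r]; rewrite !nil2_word_cat.
  have -> : nil2_word [:: (e, z), (~~ e, z) & y] =
      nil2_mul (nil2_mul (nil2_letter (e, z)) (nil2_letter (~~ e, z))) (nil2_word y).
    by rewrite -nil2_mulA.
  suff -> : nil2_mul (nil2_letter (e, z)) (nil2_letter (~~ e, z)) = nil2_1.
    by rewrite nil2_mul1.
  by case: e; case: z => [[|[|[|[|[|z]]]]] lt].
move=> rin; congr nil2_mul; suff -> : nil2_word r = nil2_1 by rewrite nil2_mul1.
by move: rin; rewrite !inE => /orP[/eqP->|/orP[/eqP->|/orP[/eqP->|/orP[/eqP->|/orP[/eqP->|/eqP->]]]]].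
Qed.

Definition sexp (w : gword) : Z := ns (nil2_word w).
Definition texp (w : gword) : Z := nt (nil2_word w).

Lemma sexp_cat u v : sexp (u ++ v) = (sexp u + sexp v)%Z.
Proof. by rewrite /sexp nil2_word_cat. Qed.

Lemma texp_cat u v : texp (u ++ v) = (texp u + texp v)%Z.
Proof. by rewrite /texp nil2_word_cat. Qed.

Lemma sexp_eqG u v : eqG u v -> sexp u = sexp v.
Proof. by move=> /eqG_nil2 E; rewrite /sexp E. Qed.

Lemma texp_eqG u v : eqG u v -> texp u = texp v.
Proof. by move=> /eqG_nil2 E; rewrite /texp E. Qed.

Lemma sexp_inv u : sexp (ginv u) = (- sexp u)%Z.
Proof. by have := sexp_eqG (eqG_mulV u); rewrite sexp_cat /sexp /=; lia. Qed.

Lemma texp_inv u : texp (ginv u) = (- texp u)%Z.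
Proof. by have := texp_eqG (eqG_mulV u); rewrite texp_cat /texp /=; lia. Qed.

Lemma sexp_wpow u n : sexp (wpow u n) = (Z.of_nat n * sexp u)%Z.
Proof. by elim: n => [|n IH] //; rewrite [wpow _ _]/= sexp_cat -/(wpow u n) IH; lia. Qed.

Lemma texp_wpow u n : texp (wpow u n) = (Z.of_nat n * texp u)%Z.
Proof. by elim: n => [|n IH] //; rewrite [wpow _ _]/= texp_cat -/(wpow u n) IH; lia. Qed.

Lemma sexp_zpow u k : sexp (zpow u k) = (k * sexp u)%Z.
Proof.
rewrite /zpow; case: Z.leb_spec => k0; rewrite sexp_wpow ?sexp_inv; first by rewrite Z2Nat.id.
by rewrite Z2Nat.id; lia.
Qed.

Lemma texp_zpow u k : texp (zpow u k) = (k * texp u)%Z.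
Proof.
rewrite /zpow; case: Z.leb_spec => k0; rewrite texp_wpow ?texp_inv; first by rewrite Z2Nat.id.
by rewrite Z2Nat.id; lia.
Qed.

(** The Heisenberg coordinates of [uv] and [vu] differ by this determinant. *)
Lemma commG_det u v : commG u v -> (sexp u * texp v = sexp v * texp u)%Z.
Proof.
by move=> /eqG_nil2; rewrite !nil2_word_cat => /(congr1 no) /=; rewrite /sexp /texp; lia.
Qed.

(** Commuting with [a] gives [s + t = 0] and [t - s + 2y = 0] in the quotient: the [b]-exponent [y]
    of [h] could offset [t - s]. Commuting with [c] forces [y = 0]. *)
Lemma commG_abc h : commG h [:: P ga] -> commG h [:: P gb] -> commG h [:: P gc] ->
  sexp h = 0%Z /\ texp h = 0%Z.
Proof.
move=> /eqG_nil2 + /eqG_nil2 + /eqG_nil2; rewrite !nil2_word_cat /sexp /texp.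
case: (nil2_word h) => x y z p q r s t o; rewrite /nil2_mul /=.
by move=> Ea Eb Ec; injection Ea => *; injection Eb => *; injection Ec => *; lia.
Qed.

(* [stw w]: only stable letters occur in [w] *)
Definition stw (w : gword) : bool := all (fun l => 2 < val l.2) w.

Lemma stw_cat u v : stw (u ++ v) = stw u && stw v.
Proof. exact: all_cat. Qed.

Lemma stw_inv u : stw (ginv u) = stw u.
Proof. by rewrite /stw /ginv all_rev all_map; apply: eq_all. Qed.

Lemma stw_zpow u k : stw u -> stw (zpow u k).
Proof.
have H v n : stw v -> stw (wpow v n).
  by move=> sv; elim: n => [|n IH] //; rewrite [wpow _ _]/= stw_cat sv.
by move=> su; rewrite /zpow; case: ifP => _; apply: H; rewrite ?stw_inv.
Qed.

Lemma stw_ind (T : gword -> Prop) : T [::] ->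
  (forall e w, T w -> T ((e, gs) :: w)) -> (forall e w, T w -> T ((e, gt) :: w)) ->
  forall w, stw w -> T w.
Proof.
move=> T0 Ts Tt; elim=> [|[e x] w IH] //= /andP[x2 sw].
have [-> | ->] : x = gs \/ x = gt; last first; [by apply/Tt/IH | by apply/Ts/IH | ].
by case: x x2 => [[|[|[|[|[|x]]]]] lt] // _; [left | right]; exact: val_inj.
Qed.

Lemma eqG_relator r : r \in relators -> eqG r [::].
Proof. by move=> rin; apply: rst_step; have := gstep_rel [::] [::] rin; rewrite cats0. Qed.

Lemma commG_stable x y : (x, y) \in [:: (gs, gb); (gs, gc); (gt, gb); (gt, gc)] ->
  commG [:: P x] [:: P y].
Proof.
move=> xy; apply/eqG_mulVP; apply: eqG_relator.
by move: xy; rewrite !inE => /orP[/eqP[-> ->]|/orP[/eqP[-> ->]|/orP[/eqP[-> ->]|/eqP[-> ->]]]].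
Qed.

Lemma commG_stable_sign e x y :
  (x, y) \in [:: (gs, gb); (gs, gc); (gt, gb); (gt, gc)] -> commG [:: (e, x)] [:: P y].
Proof.
by move=> /commG_stable H; case: e => //; exact: (commG_inv H).
Qed.

Lemma commG_stw_bc w y : stw w -> y \in [:: gb; gc] -> commG w [:: P y].
Proof.
move=> sw yin; elim/stw_ind: w / sw => [|e w IH|e w IH]; first exact: commG_nil.
all: apply: (@commG_cat [:: _]) => //; apply: commG_stable_sign.
all: by move: yin; rewrite !inE => /orP[] /eqP->.
Qed.

(** * Action of words in the stable letters on [a] *)

Definition bpow : Z -> gword := zpow [:: P gb].

Lemma eqG_sa : eqG [:: P gs; P ga] [:: P ga; P gb; P gs].
Proof.
by apply/eqG_mulVP; apply: (@eqG_relator [:: P gs; P ga; N gs; N gb; N ga]).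
Qed.

Lemma eqG_ta : eqG [:: P gt; P ga] [:: P gb; P ga; P gt].
Proof.
by apply/eqG_mulVP; apply: (@eqG_relator [:: P gt; P ga; N gt; N ga; N gb]).
Qed.

#[local] Instance eqG_equivalence : Equivalence eqG.
Proof.
by split=> [u | u v | u v w]; [exact: eqG_refl | exact: eqG_sym | exact: eqG_trans].
Qed.

#[local] Instance cat_eqG_proper : Proper (eqG ==> eqG ==> eqG) (@cat (bool * gen)).
Proof. by move=> u u' Hu v v' Hv; exact: eqG_cat. Qed.

Lemma eqG_mulVr u r : eqG (u ++ ginv u ++ r) r.
Proof. by rewrite catA (eqG_mulV u); exact: eqG_refl. Qed.

Lemma eqG_mulVlr u r : eqG (ginv u ++ u ++ r) r.
Proof. by rewrite catA (eqG_mulVl u); exact: eqG_refl. Qed.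

Lemma commG_swap u v r : commG u v -> eqG (u ++ v ++ r) (v ++ u ++ r).
Proof. by move=> H; rewrite !catA; apply: eqG_cat => //; exact: eqG_refl. Qed.

(** The hypothesis reads [u x u^-1 = y x z]; conjugate back by [u], which fixes [y] and [z]. *)
Lemma eqG_twist_inv u x y z : eqG (u ++ x) (y ++ x ++ z ++ u) ->
  commG u y -> commG u z ->
  eqG (ginv u ++ x) (ginv y ++ x ++ ginv z ++ ginv u).
Proof.
move=> H Cy Cz.
have Hr r : eqG (u ++ x ++ r) (y ++ x ++ z ++ u ++ r).
  by rewrite catA H -!catA; exact: eqG_refl.
have Cy' := commG_sym (commG_inv (commG_sym Cy)).
have Cz' := commG_sym (commG_inv (commG_sym Cz)).
suff E : eqG x (u ++ ginv y ++ x ++ ginv z ++ ginv u).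
  rewrite {1}E; exact: eqG_mulVlr.
rewrite (commG_swap _ Cy') Hr eqG_mulVlr (commG_swap _ Cz') eqG_mulVr (eqG_mulV u) cats0.
exact: eqG_refl.
Qed.

Lemma commG_stw_bpow w k : stw w -> commG w (bpow k).
Proof.
by move=> sw; apply: commG_sym; apply: commG_zpow; apply: commG_sym; exact: commG_stw_bc.
Qed.

Definition zsign (e : bool) : Z := if e then 1%Z else (-1)%Z.

Lemma eqG_letter_sa e :
  eqG ([:: (e, gs)] ++ [:: P ga]) ([:: P ga] ++ bpow (zsign e) ++ [:: (e, gs)]).
Proof.
case: e; first exact: eqG_sa.
apply: (@eqG_twist_inv [:: P gs] [:: P ga] [::] [:: P gb]); first exact: eqG_sa.
  by apply: commG_sym; exact: commG_nil.
exact: commG_stable.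
Qed.

Lemma eqG_letter_ta e :
  eqG ([:: (e, gt)] ++ [:: P ga]) (bpow (zsign e) ++ [:: P ga] ++ [:: (e, gt)]).
Proof.
case: e; first exact: eqG_ta.
apply: (@eqG_twist_inv [:: P gt] [:: P ga] [:: P gb] [::]); first exact: eqG_ta.
  exact: commG_stable.
by apply: commG_sym; exact: commG_nil.
Qed.

Lemma bpow_sign e k : eqG (bpow (zsign e) ++ bpow k) (bpow (zsign e + k)).
Proof. by case: e; apply: eqG_sym; [exact: zpowS | exact: zpowP]. Qed.

Lemma commG_bpow k l : commG (bpow k) (bpow l).
Proof.
by apply: commG_zpow; apply: commG_sym; apply: commG_zpow; exact: commG_refl.
Qed.

(** Passing [a], each [t] leaves a [b] on its left and each [s] one on its right. Stable letters
    commute with [b], so the two counts accumulate separately, whatever the order of the letters. *)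
Lemma eqG_stw_a w : stw w ->
  eqG (w ++ [:: P ga]) (bpow (texp w) ++ [:: P ga] ++ bpow (sexp w) ++ w).
Proof.
move=> sw; elim/stw_ind: w / sw => [|e w IH|e w IH]; first exact: eqG_refl.
- have -> : texp ((e, gs) :: w) = texp w by rewrite -cat1s texp_cat.
  have -> : sexp ((e, gs) :: w) = (zsign e + sexp w)%Z.
    by rewrite -cat1s sexp_cat; case: e.
  have sl : stw [:: (e, gs)] by [].
  rewrite -cat1s -catA IH (commG_swap _ (commG_stw_bpow _ sl)).
  rewrite (catA [:: (e, gs)] [:: P ga]) (eqG_letter_sa e).
  rewrite -!catA (commG_swap _ (commG_stw_bpow _ sl)) -(bpow_sign e) -!catA.
  exact: eqG_refl.
- have -> : texp ((e, gt) :: w) = (zsign e + texp w)%Z.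
    by rewrite -cat1s texp_cat; case: e.
  have -> : sexp ((e, gt) :: w) = sexp w by rewrite -cat1s sexp_cat.
  have sl : stw [:: (e, gt)] by [].
  rewrite -cat1s -catA IH (commG_swap _ (commG_stw_bpow _ sl)).
  rewrite (catA [:: (e, gt)] [:: P ga]) (eqG_letter_ta e).
  rewrite -!catA (commG_swap _ (commG_stw_bpow _ sl)) -(bpow_sign e) -!catA.
  rewrite (commG_swap _ (commG_bpow (texp w) (zsign e))).
  exact: eqG_refl.
Qed.

Lemma commG_stw_a w : stw w -> sexp w = 0%Z -> texp w = 0%Z -> commG w [:: P ga].
Proof. by move=> sw s0 t0; have := eqG_stw_a sw; rewrite s0 t0. Qed.

(** * Polynomial equations as systems over the group *)

Lemma sexp_s : sexp [:: P gs] = 1%Z. Proof. by []. Qed.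
Lemma texp_s : texp [:: P gs] = 0%Z. Proof. by []. Qed.
Lemma sexp_t : sexp [:: P gt] = 0%Z. Proof. by []. Qed.
Lemma texp_t : texp [:: P gt] = 1%Z. Proof. by []. Qed.

Definition einv (w : eqword) : eqword := rev (map (fun l => (~~ l.1, l.2)) w).

Lemma subst_cat sigma u v : subst sigma (u ++ v) = subst sigma u ++ subst sigma v.
Proof. by rewrite /subst map_cat flatten_cat. Qed.

Lemma subst_einv sigma w : subst sigma (einv w) = ginv (subst sigma w).
Proof.
elim: w => [|l w IH] //; rewrite -cat1s subst_cat ginv_cat -IH.
rewrite /einv map_cat rev_cat subst_cat; congr cat.
by case: l => -[] [x|i]; rewrite /subst /= ?cats0 ?ginvK.
Qed.

Definition sat (sigma : nat -> gword) (S : eqsystem) : Prop :=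
  forall w, w \in S -> eqG (subst sigma w) [::].

Lemma sat_nil sigma : sat sigma [::]. Proof. by []. Qed.

Lemma sat_cons sigma w S : sat sigma (w :: S) <-> eqG (subst sigma w) [::] /\ sat sigma S.
Proof.
split=> [H | [Hw HS] u]; last by rewrite inE => /predU1P[-> | /HS].
by split=> [|u uS]; apply: H; rewrite inE ?eqxx // uS orbT.
Qed.

Lemma sat_cat sigma S S' : sat sigma (S ++ S') <-> sat sigma S /\ sat sigma S'.
Proof.
split=> [H | [HS HS'] u]; last by rewrite mem_cat => /orP[/HS | /HS'].
by split=> u uS; apply: H; rewrite mem_cat uS ?orbT.
Qed.

Definition eqn (l r : eqword) : eqword := l ++ einv r.

Lemma subst_eqn sigma l r :
  eqG (subst sigma (eqn l r)) [::] <-> eqG (subst sigma l) (subst sigma r).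
Proof. by rewrite subst_cat subst_einv eqG_mulVP. Qed.

Definition ecomm (u v : eqword) : eqword := eqn (u ++ v) (v ++ u).

Lemma subst_ecomm sigma u v :
  eqG (subst sigma (ecomm u v)) [::] <-> commG (subst sigma u) (subst sigma v).
Proof. by rewrite subst_eqn !subst_cat. Qed.

Definition econst (x : gen) : eqword := [:: (true, inl x)].
Definition evar (i : nat) : eqword := [:: (true, inr i)].

Lemma subst_econst sigma x : subst sigma (econst x) = [:: P x]. Proof. by []. Qed.

Lemma subst_evar sigma i : subst sigma (evar i) = sigma i.
Proof. by rewrite /subst /= cats0. Qed.

(* [elink l r] says that [r^-1 l] centralises [F_3], hence that [l] and [r] have
   the same exponents in [s] and [t]. *)
Definition elink (l r : eqword) : eqsystem :=
  [seq ecomm (einv r ++ l) (econst x) | x <- [:: ga; gb; gc]].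

Lemma elink_sound sigma l r : sat sigma (elink l r) ->
  sexp (subst sigma l) = sexp (subst sigma r) /\
  texp (subst sigma l) = texp (subst sigma r).
Proof.
move=> /sat_cons[/subst_ecomm Ha /sat_cons[/subst_ecomm Hb /sat_cons[/subst_ecomm Hc _]]].
have [] := commG_abc Ha Hb Hc.
by rewrite !subst_cat !subst_einv sexp_cat texp_cat sexp_inv texp_inv; lia.
Qed.

Lemma elink_complete sigma l r : stw (subst sigma l) -> stw (subst sigma r) ->
  sexp (subst sigma l) = sexp (subst sigma r) ->
  texp (subst sigma l) = texp (subst sigma r) -> sat sigma (elink l r).
Proof.
move=> sl sr Es Et.
have sh : stw (subst sigma (einv r ++ l)) by rewrite subst_cat subst_einv stw_cat stw_inv sr.
apply/sat_cons; split; last apply/sat_cons; last split; last (apply/sat_cons; split=> //).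
- apply/subst_ecomm; apply: (commG_stw_a sh);
  by rewrite subst_cat subst_einv ?sexp_cat ?texp_cat ?sexp_inv ?texp_inv; lia.
- by apply/subst_ecomm; exact: (commG_stw_bc sh).
- by apply/subst_ecomm; exact: (commG_stw_bc sh).
Qed.

(* The integer [n] is represented by elements commuting with [s] whose exponent
   in [s] is [n].  For a product [z = x y], [y'] is the copy of [y] in [<t>],
   transported by [v] in [<s t>], and [u] is a power of [t x], so that the
   exponent of [u] in [s] is that of [x] times that of [u] in [t]. *)
Definition emul (x y z y' u v : eqword) : eqsystem :=
  [:: ecomm z (econst gs); ecomm y' (econst gt); ecomm u (econst gt ++ x);
      ecomm v (econst gs ++ econst gt)] ++ elink u (z ++ y') ++ elink v (y ++ y').

(** Commuting with [s t] equates the two exponents of [v], so the [t]-exponent of [y'] is the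
    [s]-exponent of [y]; the link makes it the [t]-exponent of [u], whose [s]-exponent is that of
    [z]. *)
Lemma emul_sound sigma x y z y' u v : sat sigma (emul x y z y' u v) ->
  texp (subst sigma x) = 0%Z -> texp (subst sigma y) = 0%Z ->
  texp (subst sigma z) = 0%Z /\
  sexp (subst sigma z) = (sexp (subst sigma x) * sexp (subst sigma y))%Z.
Proof.
move=> /sat_cat[/sat_cons[/subst_ecomm/commG_det + /sat_cons[/subst_ecomm/commG_det +
  /sat_cons[/subst_ecomm/commG_det + /sat_cons[/subst_ecomm/commG_det + _]]]]].
move=> Hz Hy' Hu Hv /sat_cat[/elink_sound[Eu1 Eu2] /elink_sound[Ev1 Ev2]] tx ty.
rewrite ?subst_cat ?subst_econst ?sexp_cat ?texp_cat ?sexp_s ?texp_s ?sexp_t ?texp_t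
  in Hz Hy' Hu Hv Eu1 Eu2 Ev1 Ev2.
rewrite tx ty in Hu Ev2 *.
split; first by lia.
nia.
Qed.

Lemma emul_complete sigma x y z y' u v m k :
  stw (subst sigma x) -> texp (subst sigma x) = 0%Z -> sexp (subst sigma x) = m ->
  stw (subst sigma y) -> texp (subst sigma y) = 0%Z -> sexp (subst sigma y) = k ->
  subst sigma z = zpow [:: P gs] (m * k) -> subst sigma y' = zpow [:: P gt] k ->
  subst sigma u = zpow ([:: P gt] ++ subst sigma x) k ->
  subst sigma v = zpow ([:: P gs] ++ [:: P gt]) k -> sat sigma (emul x y z y' u v).
Proof.
move=> wx tx sx wy ty sy Ez Ey Eu Ev.
apply/sat_cat; split; last (apply/sat_cat; split).
- apply/sat_cons; split.
    by apply/subst_ecomm; rewrite Ez; apply: commG_zpow; exact: commG_refl.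
  apply/sat_cons; split.
    by apply/subst_ecomm; rewrite Ey; apply: commG_zpow; exact: commG_refl.
  apply/sat_cons; split.
    by apply/subst_ecomm; rewrite Eu subst_cat; apply: commG_zpow; exact: commG_refl.
  apply/sat_cons; split; last exact: sat_nil.
  by apply/subst_ecomm; rewrite Ev; apply: commG_zpow; exact: commG_refl.
- apply: elink_complete; rewrite ?subst_cat ?Eu ?Ez ?Ey.
  + by apply: stw_zpow; rewrite stw_cat wx.
  + by rewrite stw_cat !stw_zpow.
  + by rewrite sexp_cat !sexp_zpow sexp_cat sexp_s sexp_t sx; lia.
  + by rewrite texp_cat !texp_zpow texp_cat texp_s texp_t tx; lia.
- apply: elink_complete; rewrite ?subst_cat ?Ev ?Ey.
  + exact: stw_zpow.
  + by rewrite stw_cat wy stw_zpow.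
  + by rewrite sexp_cat !sexp_zpow sexp_cat sexp_s sexp_t sy; lia.
  + by rewrite texp_cat !texp_zpow texp_cat texp_s texp_t ty; lia.
Qed.

(** * Translation of polynomials into systems *)

Fixpoint zeval (n : Z) (w : nat -> Z) (p : pexp) : Z :=
  match p with
  | Par _ => n
  | Wit i => w i
  | Cst c => Z.of_nat c
  | Add p q => (zeval n w p + zeval n w q)%Z
  | Mul p q => (zeval n w p * zeval n w q)%Z
  end.

(** An injective coding lets every subterm name its own unknowns, so no supply of fresh variables is
    threaded through. *)
Fixpoint tree_of_pexp (p : pexp) : GenTree.tree nat :=
  match p with
  | Par i => GenTree.Node 0 [:: GenTree.Leaf i]
  | Wit i => GenTree.Node 1 [:: GenTree.Leaf i]
  | Cst i => GenTree.Node 2 [:: GenTree.Leaf i]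
  | Add p q => GenTree.Node 3 [:: tree_of_pexp p; tree_of_pexp q]
  | Mul p q => GenTree.Node 4 [:: tree_of_pexp p; tree_of_pexp q]
  end.

Fixpoint pexp_of_tree (t : GenTree.tree nat) : option pexp :=
  match t with
  | GenTree.Node 0 [:: GenTree.Leaf i] => Some (Par i)
  | GenTree.Node 1 [:: GenTree.Leaf i] => Some (Wit i)
  | GenTree.Node 2 [:: GenTree.Leaf i] => Some (Cst i)
  | GenTree.Node k [:: t1; t2] =>
      if pexp_of_tree t1 is Some p then
        if pexp_of_tree t2 is Some q then
          Some (if k == 3 then Add p q else Mul p q)
        else None
      else None
  | _ => None
  end.

Lemma tree_of_pexpK : pcancel tree_of_pexp pexp_of_tree.
Proof. by elim=> //= p -> q ->. Qed.

(* Variable [0] carries the parameter. *)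
Definition pvar (p : pexp) (tag : nat) : nat := (pickle (tree_of_pexp p, tag)).+1.

(** Concatenation adds exponents, so only witnesses and products need unknowns of their own. *)
Fixpoint pterm (p : pexp) : eqword :=
  match p with
  | Par _ => evar 0
  | Cst c => nseq c (true, inl gs)
  | Add p q => pterm p ++ pterm q
  | Wit _ | Mul _ _ => evar (pvar p 0)
  end.

Fixpoint psys (p : pexp) : eqsystem :=
  match p with
  | Par _ | Cst _ => [::]
  | Wit i => [:: ecomm (pterm p) (econst gs)]
  | Add p q => psys p ++ psys q
  | Mul p1 q1 => psys p1 ++ psys q1 ++ emul (pterm p1) (pterm q1) (evar (pvar p 0))
      (evar (pvar p 1)) (evar (pvar p 2)) (evar (pvar p 3))
  end.

Definition equation_system (p q : pexp) : eqsystem :=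
  psys p ++ psys q ++ elink (pterm p) (pterm q).

Definition parameter_eqn (n : nat) : eqword :=
  (false, inr 0) :: nseq n (true, inl gs).

Lemma subst_nseq sigma c x : subst sigma (nseq c (true, inl x)) = wpow [:: P x] c.
Proof. by rewrite /subst map_nseq. Qed.

Lemma subst_parameter_eqn sigma n :
  eqG (subst sigma (parameter_eqn n)) [::] <-> eqG (wpow [:: P gs] n) (sigma 0).
Proof.
rewrite -(subst_nseq sigma).
have -> : subst sigma (parameter_eqn n) =
    ginv (sigma 0) ++ subst sigma (nseq n (true, inl gs)) by [].
exact: eqG_mulVlP.
Qed.

Lemma psys_sound sigma n p : eqG (wpow [:: P gs] n) (sigma 0) -> sat sigma (psys p) ->
  texp (subst sigma (pterm p)) = 0%Z /\ sexp (subst sigma (pterm p)) =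
    zeval (Z.of_nat n) (fun i => sexp (sigma (pvar (Wit i) 0))) p.
Proof.
move=> H0; elim: p => [i|i|c|p IHp q IHq|p IHp q IHq].
- by rewrite subst_evar -(texp_eqG H0) -(sexp_eqG H0) sexp_wpow texp_wpow
    sexp_s texp_s [zeval _ _ _]/=; lia.
- move=> /sat_cons[/subst_ecomm/commG_det + _]; rewrite [pterm _]/= subst_evar subst_econst.
  by rewrite sexp_s texp_s [zeval _ _ _]/=; lia.
- by rewrite subst_nseq sexp_wpow texp_wpow
    sexp_s texp_s [zeval _ _ _]/=; lia.
- move=> /sat_cat[/IHp[tp sp] /IHq[tq sq]].
  by rewrite [pterm _]/= subst_cat sexp_cat texp_cat tp tq sp sq.
- move=> /sat_cat[/IHp[tp sp] /sat_cat[/IHq[tq sq] /emul_sound]].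
  by rewrite tp tq sp sq => /(_ erefl erefl).
Qed.

Fixpoint pword (n : nat) (w : nat -> Z) (p : pexp) : gword :=
  match p with
  | Par _ => wpow [:: P gs] n
  | Wit i => zpow [:: P gs] (w i)
  | Cst c => wpow [:: P gs] c
  | Add p q => pword n w p ++ pword n w q
  | Mul _ _ => zpow [:: P gs] (zeval (Z.of_nat n) w p)
  end.

Lemma pword_exp n w p : stw (pword n w p) /\ texp (pword n w p) = 0%Z /\
  sexp (pword n w p) = zeval (Z.of_nat n) w p.
Proof.
have sw k : stw (wpow [:: P gs] k) by rewrite -zpow_nat stw_zpow.
elim: p => [i|i|c|p [sp [tp ep]] q [sq [tq eq]]|p _ q _]; rewrite [pword _ _ _]/= [zeval _ _ _]/=.
- by rewrite sw texp_wpow sexp_wpow texp_s sexp_s; lia.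
- by rewrite stw_zpow // texp_zpow sexp_zpow texp_s sexp_s; lia.
- by rewrite sw texp_wpow sexp_wpow texp_s sexp_s; lia.
- by rewrite stw_cat sp sq texp_cat sexp_cat tp tq ep eq.
- by rewrite stw_zpow // texp_zpow sexp_zpow texp_s sexp_s Z.mul_0_r Z.mul_1_r.
Qed.

(** For a product, the tags [0] to [3] are the [z], [y'], [u], [v] of [emul]. *)
Definition pval (n : nat) (w : nat -> Z) (p : pexp) (tag : nat) : gword :=
  if p is Mul p1 q1 then
    let k := zeval (Z.of_nat n) w q1 in
    match tag with
    | 0 => pword n w p
    | 1 => zpow [:: P gt] k
    | 2 => zpow ([:: P gt] ++ pword n w p1) k
    | _ => zpow [:: P gs; P gt] k
    end
  else pword n w p.

(** Decodes a variable to its subterm; the empty word is the value where nothing decodes. *)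
Definition psol (n : nat) (w : nat -> Z) (i : nat) : gword :=
  if i is j.+1 then
    if (unpickle j : option (GenTree.tree nat * nat)) is Some (t, tag) then
      if pexp_of_tree t is Some p then pval n w p tag else [::]
    else [::]
  else wpow [:: P gs] n.

Lemma psol_pvar n w p tag : psol n w (pvar p tag) = pval n w p tag.
Proof. by rewrite /psol /pvar pickleK tree_of_pexpK. Qed.

Lemma subst_pterm n w p : subst (psol n w) (pterm p) = pword n w p.
Proof.
elim: p => [i|i|c|p IHp q IHq|p IHp q IHq].
- by rewrite subst_evar.
- by rewrite subst_evar psol_pvar.
- by rewrite subst_nseq.
- by rewrite [pterm _]/= subst_cat IHp IHq.
- by rewrite subst_evar psol_pvar.
Qed.

Lemma psys_complete n w p : sat (psol n w) (psys p).
Proof.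
elim: p => [i|i|c|p IHp q IHq|p IHp q IHq] //; last 2 first.
- by apply/sat_cat.
- apply/sat_cat; split=> //; apply/sat_cat; split=> //.
  have [sp [tp ep]] := pword_exp n w p; have [sq [tq eq]] := pword_exp n w q.
  apply: (@emul_complete _ _ _ _ _ _ _ (zeval (Z.of_nat n) w p) (zeval (Z.of_nat n) w q)).
  1-6: by rewrite subst_pterm.
  3: rewrite (subst_pterm n w p).
  1-4: by rewrite subst_evar psol_pvar.
- apply/sat_cons; split=> //; apply/subst_ecomm; rewrite subst_pterm.
  by apply: commG_zpow; exact: commG_refl.
Qed.

Lemma solvable_equation_system n p q :
  solvable (parameter_eqn n :: equation_system p q) <->
  exists w, zeval (Z.of_nat n) w p = zeval (Z.of_nat n) w q.
Proof.
split=> [[sigma] | [w E]].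
  move=> /sat_cons[/subst_parameter_eqn H0 /sat_cat[Hp /sat_cat[Hq /elink_sound[Es _]]]].
  exists (fun i => sexp (sigma (pvar (Wit i) 0))).
  by have [_ <-] := psys_sound H0 Hp; have [_ <-] := psys_sound H0 Hq.
exists (psol n w); apply/sat_cons; split.
  by apply/subst_parameter_eqn; exact: eqG_refl.
apply/sat_cat; split; first exact: psys_complete.
apply/sat_cat; split; first exact: psys_complete.
have [sp [tp ep]] := pword_exp n w p; have [sq [tq eq]] := pword_exp n w q.
by apply: elink_complete; rewrite !subst_pterm ?ep ?eq ?tp ?tq.
Qed.

(** Exponents range over all integers, so each natural unknown [i] is replaced by four integer ones,
    numbered [4i] to [4i + 3]. *)
Definition four_squares (i : nat) : pexp :=
  let sq j := Mul (Wit (4 * i + j)) (Wit (4 * i + j)) in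
  Add (Add (sq 0) (sq 1)) (Add (sq 2) (sq 3)).

Lemma zeval_four_squares n w z p :
  (forall i, zeval (Z.of_nat n) z (four_squares i) = Z.of_nat (w i)) ->
  zeval (Z.of_nat n) z (psubst Par four_squares p) = Z.of_nat (peval (fun=> n) w p).
Proof.
move=> H; elim: p => [i|i|c|p IHp q IHq|p IHp q IHq] //; cbn [psubst zeval peval].
- exact: H.
- by rewrite IHp IHq; lia.
- by rewrite IHp IHq; lia.
Qed.

Lemma four_squares_choice (w : nat -> nat) :
  exists z, forall n i, zeval n z (four_squares i) = Z.of_nat (w i).
Proof.
have ex i : exists x : nat * nat * (nat * nat),
    x.1.1 * x.1.1 + x.1.2 * x.1.2 + (x.2.1 * x.2.1 + x.2.2 * x.2.2) == w i.
  have [a [b [c [d E]]]] := nat_sum4sq (w i).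
  exists (Z.abs_nat a, Z.abs_nat b, (Z.abs_nat c, Z.abs_nat d)); apply/eqP => /=.
  have sq x : Z.of_nat (Z.abs_nat x * Z.abs_nat x) = (x * x)%Z by nia.
  by have := sq a; have := sq b; have := sq c; have := sq d; lia.
pose x i := xchoose (ex i).
exists (fun j => Z.of_nat (nth 0 [:: (x (j %/ 4)).1.1; (x (j %/ 4)).1.2;
  (x (j %/ 4)).2.1; (x (j %/ 4)).2.2] (j %% 4))) => n i.
have D j : j < 4 -> (4 * i + j) %/ 4 = i by move=> j4; rewrite mulnC divnMDl // divn_small // addn0.
have M j : j < 4 -> (4 * i + j) %% 4 = j by move=> j4; rewrite mulnC modnMDl modn_small.
rewrite /four_squares; cbn [zeval]; rewrite !D // !M //.
by have /eqP := xchooseP (ex i); rewrite -/(x i) /=; lia.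
Qed.

Lemma dioph_solvable R : dioph R -> exists D, forall n : nat,
  solvable (parameter_eqn n :: D) <-> R (fun=> n).
Proof.
move=> [p [q H]].
exists (equation_system (psubst Par four_squares p) (psubst Par four_squares q)) => n.
rewrite solvable_equation_system H; split=> [[z] | [w]] E.
  pose w i := Z.to_nat (zeval (Z.of_nat n) z (four_squares i)).
  have Hw i : zeval (Z.of_nat n) z (four_squares i) = Z.of_nat (w i).
    by rewrite Z2Nat.id //=; nia.
  by exists w; move: E; rewrite !(zeval_four_squares _ Hw); lia.
have [z Hz] := four_squares_choice w; exists z.
by rewrite !(@zeval_four_squares n w) ?E.
Qed.

(** * Diagonalisation *)

(** A geometric sum: with [X = 2^(b+1)], the code [c] satisfies [c (X - 1) = 2^b (X^n - 1)], stated
    without subtraction. *)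
Lemma code_nseq b n :
  CodeSeq.code (nseq n b) * 2 ^ b.+1 + 2 ^ b = CodeSeq.code (nseq n b) + 2 ^ b * (2 ^ b.+1) ^ n.
Proof.
elim: n => [|n IH]; first by rewrite /= expn0 muln1.
have -> : CodeSeq.code (nseq n.+1 b) = CodeSeq.code (nseq n b) * 2 ^ b.+1 + 2 ^ b.
  by rewrite /= expnS -addnn; lia.
rewrite [(2 ^ b.+1) ^ n.+1]expnS; move: (_ ^ n) (CodeSeq.code _) IH => Q c IH.
rewrite {1}IH mulnDl IH; lia.
Qed.

Lemma dioph_code_nseq b f g : poly f -> poly g ->
  dioph (fun e => f e = CodeSeq.code (nseq (g e) b)).
Proof.
apply: (@dioph_app2 (fun c n => c = CodeSeq.code (nseq n b))).
apply: (@dioph_ext (fun e => exists q,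
    q = (2 ^ b.+1) ^ e 1 /\ e 0 * 2 ^ b.+1 + 2 ^ b = e 0 + 2 ^ b * q)) => [e|].
  split=> [[_ [-> E]] | ->]; last by eexists; split; last exact: code_nseq.
  move: (code_nseq b (e 1)) E; move: (_ ^ e 1) (CodeSeq.code _) => Q c.
  have : 2 <= 2 ^ b.+1 by rewrite -{1}(expn1 2) leq_exp2l.
  by move: (2 ^ b.+1) (2 ^ b) => X Y *; nia.
apply: dioph_ex; apply: dioph_and; last by dio.
by apply: dioph_expn; poly_tac.
Qed.

Lemma pickle_cons (T : countType) (x : T) (s : seq T) :
  pickle (x :: s) = 2 ^ pickle x * (2 * pickle s + 1).
Proof. by rewrite mul2n addn1. Qed.

Lemma pickle_nseq (T : countType) (x : T) n :
  pickle (nseq n x) = CodeSeq.code (nseq n (pickle x)).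
Proof. by rewrite -map_nseq. Qed.

Lemma pickle_parameter_eqn n (D : eqsystem) :
  pickle (parameter_eqn n :: D) =
  2 ^ (2 ^ pickle ((false, inr 0) : eqletter) *
       (2 * CodeSeq.code (nseq n (pickle ((true, inl gs) : eqletter))) + 1)) *
  (2 * pickle D + 1).
Proof. by rewrite pickle_cons /parameter_eqn pickle_cons pickle_nseq. Qed.

(** The single parameter is both the exponent of [s] and the code of [D]; [a] and [b] stand for the
    codes of the letters [x_0^-1] and [s]. *)
Lemma dioph_diagonal f a b : dioph (fun e => exists y, reval f [:: y] 0 /\
  y = 2 ^ (2 ^ a * (2 * CodeSeq.code (nseq (e 0) b) + 1)) * (2 * e 0 + 1)).
Proof.
apply: (@dioph_ext (fun e => exists y z c p, reval f [:: y] z /\ z = 0 /\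
    c = CodeSeq.code (nseq (e 0) b) /\ p = 2 ^ (2 ^ a * (2 * c + 1)) /\
    y = p * (2 * e 0 + 1))) => [e|].
  split=> [[y [z [c [p [H [Ez [Ec [Ep Ey]]]]]]]] | [y [H Ey]]].
    by exists y; split; [rewrite -Ez | rewrite -Ec -Ep].
  by exists y, 0; do 2 eexists; do 4 (split; first by []); exact: Ey.
do 4 apply: dioph_ex; apply: dioph_and; first exact: (dioph_reval f [:: 3] 2).
apply: dioph_and; first by dio.
apply: dioph_and; first by apply: dioph_code_nseq; poly_tac.
apply: dioph_and; last by dio.
by apply: dioph_expn; poly_tac.
Qed.

Theorem theorem6p5 : ~ diophantine_decidable.
Proof.
move=> [f dec].
have [D HD] := dioph_solvable (dioph_diagonal f (pickle ((false, inr 0) : eqletter))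
  (pickle ((true, inl gs) : eqletter))).
have key : solvable (parameter_eqn (pickle D) :: D) <->
    reval f [:: pickle (parameter_eqn (pickle D) :: D)] 0.
  rewrite HD pickle_parameter_eqn; split=> [[y [H <-]] // | H].
  by eexists; split; first exact: H.
have [yes no] := dec (parameter_eqn (pickle D) :: D).
(* A solution would make [f] output both [1] and [0]. Unsolvability then yields output [0], hence a
   solution; no case distinction on solvability is made. *)
have unsolvable : ~ solvable (parameter_eqn (pickle D) :: D).
  by move=> s; have := reval_inj (yes s) (proj1 key s).
exact/unsolvable/key/no.
Qed.
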